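(* Let $G$ be a group considered with the discrete topology. Then $\mathcal{R}_{vN}(G)=G$ if and only if $\mathcal{R}_{tc}(G)=G$. That is, the class of type-absolutely connected groups coincides with the class of discretely topologized minimally almost periodic groups.
   Context: Bohr compactification: for a topological group $G$ there is a compact Hausdorff group $bG$ and a continuous homomorphism $b\colon G\to bG$ with dense image such that every continuous homomorphism with dense image $f\colon G\to\widetilde G$ into a compact Hausdorff group factors uniquely as $f=\widetilde f\circ b$ with $\widetilde f\colon bG\to\widetilde G$ a continuous surjective homomorphism. The von Neumann radical is $\mathcal{R}_{vN}(G)=\ker(b)$. $G$ is minimally almost periodic if $\mathcal{R}_{vN}(G)=G$, i.e. $bG$ is trivial. A subset $P$ of a group $G$ is $n$-thick if $P=P^{-1}$ and for every sequence $g_1,\dots,g_n$ in $G$ (not necessarily distinct) there are $1\le i<j\le n$ with $g_i^{-1}g_j\in P$; thick means $n$-thick for some $n\in\mathbb{N}$. A group $G$ is type-absolutely connected if for any sufficiently saturated elementary extension $G^*$ of any first-order expansion $(G,\cdot,\dots)$ of $G$, one has $G^*={G^*}^{00}_G$, where ${G^*}^{00}_G$ is the smallest subgroup of $G^*$ of bounded index type-definable over $G$. Equivalently, for every family $\{P_n:n\in\mathbb{N}\}$ of thick subsets of $G$ with $P_{n+1}P_{n+1}\subseteq P_n$ for all $n$, one has $P_n=G$ for all $n$. $\mathcal{R}_{tc}(G)$ denotes the largest type-absolutely connected subgroup of $G$, i.e. the subgroup which is itself type-absolutely connected and contains all type-absolutely connected subgroups of $G$ (it exists). *)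

(* Defs.v *)
From HB Require Import structures.
From mathcomp Require Import all_boot.
From mathcomp Require Import monoid.
From mathcomp Require Import boolp classical_sets functions cardinality.
From mathcomp Require Import topology.

Set Implicit Arguments.
Unset Strict Implicit.
Unset Printing Implicit Defensive.

Local Open Scope classical_set_scope.
Local Open Scope card_scope.
Local Open Scope group_scope.

Section Subgroups.
Variable G : groupType.

Definition is_subgroup (H : set G) : Prop :=
  [/\ H 1, forall x y, H x -> H y -> H (x * y) & forall x, H x -> H x^-1].

Definition left_cosets (H : set G) : set (set G) :=
  [set [set y | H (x^-1 * y)] | x in [set: G]].

Definition subgroup_type (H : set G) (_ : is_subgroup H) : Type := set_type H.

End Subgroups.

Section SubgroupGroup.
Variables (G : groupType) (H : set G) (Hsub : is_subgroup H).

Lemma is_subgroup_closed : group_closed (mem H).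
Proof.
case: Hsub => H1 HM HV; split; first exact/mem_set.
by move=> x y /set_mem Hx /set_mem Hy; apply/mem_set/HM => //; exact: HV.
Qed.

HB.instance Definition _ := SubChoice.copy (subgroup_type Hsub) (set_type H).
HB.instance Definition _ :=
  SubChoice_isSubGroup.Build G (mem H) (subgroup_type Hsub) is_subgroup_closed.

End SubgroupGroup.

HB.mixin Record isTopologicalGroup G of Topological G & Group G := {
  mulg_continuous : continuous (fun xy : G * G => xy.1 * xy.2);
  invg_continuous : continuous (fun x : G => x^-1)
}.

#[short(type="topGroupType")]
HB.structure Definition TopologicalGroup :=
  {G of Topological G & Group G & isTopologicalGroup G}.

Section DiscreteGroup.
Variable G : groupType.

HB.instance Definition _ := Group.copy (discrete_topology G) G.

Lemma discrete_mulg_continuous :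
  continuous (fun xy : discrete_topology G * discrete_topology G =>
    xy.1 * xy.2).
Proof.
move=> [x y] A /= /nbhs_singleton Axy.
exists ([set x], [set y]); first by split; exact: discrete_set1.
by move=> [u v] [/= -> ->].
Qed.

Lemma discrete_invg_continuous :
  continuous (fun x : discrete_topology G => x^-1).
Proof.
move=> x A /= /nbhs_singleton Ax.
by apply: (filterS _ (discrete_set1 x)) => ? ->.
Qed.

HB.instance Definition _ :=
  isTopologicalGroup.Build (discrete_topology G)
    discrete_mulg_continuous discrete_invg_continuous.

End DiscreteGroup.

Definition compact_hausdorff (K : topologicalType) : Prop :=
  compact [set: K] /\ hausdorff_space K.

Definition continuous_hom (G K : topGroupType) (f : G -> K) : Prop :=
  continuous f /\ {morph f : x y / x * y}.

Definition is_bohr_compactification (G bG : topGroupType) (b : G -> bG) : Prop :=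
  [/\ compact_hausdorff bG, continuous_hom b, dense (range b) &
      forall (K : topGroupType) (f : G -> K),
        compact_hausdorff K -> continuous_hom f -> dense (range f) ->
        exists! f' : bG -> K,
          [/\ continuous_hom f', range f' = [set: K] & f = f' \o b]].

(* ker b, for b the Bohr compactification; the latter is unique up to
   isomorphism, so ker b does not depend on which one is taken. *)
Definition von_Neumann_radical (G : topGroupType) : set G :=
  [set g | exists (bG : topGroupType) (b : G -> bG),
     is_bohr_compactification b /\ b g = 1].
Arguments von_Neumann_radical : clear implicits.

Definition minimally_almost_periodic (G : topGroupType) : Prop :=
  von_Neumann_radical G = [set: G].

(* The non-logical symbols of an expansion (G, *, ...) other than the group
   multiplication, which is built into terms below. *)
Record language : Type := Language {
  fsym : Type;
  farity : fsym -> nat;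
  rsym : Type;
  rarity : rsym -> nat
}.

Inductive term (L : language) : Type :=
| tVar of nat
| tMul of term L & term L
| tFun (f : fsym L) of ('I_(farity f) -> term L).

Inductive formula (L : language) : Type :=
| fEq of term L & term L
| fRel (r : rsym L) of ('I_(rarity r) -> term L)
| fFalse
| fImp of formula L & formula L
| fAll of nat & formula L.

Record expansion (L : language) (G : Type) : Type := Expansion {
  finterp : forall f : fsym L, ('I_(farity f) -> G) -> G;
  rinterp : forall r : rsym L, ('I_(rarity r) -> G) -> Prop
}.

Section Semantics.
Variables (L : language) (G : groupType) (E : expansion L G).

Fixpoint eval (v : nat -> G) (t : term L) : G :=
  match t with
  | tVar n => v n
  | tMul t1 t2 => eval v t1 * eval v t2
  | tFun f ts => finterp E (fun i => eval v (ts i))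
  end.

Fixpoint sat (v : nat -> G) (phi : formula L) : Prop :=
  match phi with
  | fEq t1 t2 => eval v t1 = eval v t2
  | fRel r ts => rinterp E (fun i => eval v (ts i))
  | fFalse => False
  | fImp phi1 phi2 => sat v phi1 -> sat v phi2
  | fAll n phi1 => forall x : G, sat (fun k => if k == n then x else v k) phi1
  end.

(* The pair (phi, a) stands for the formula phi(x, a) with parameters from G
   in the single free variable x: variable 0 is x, and variable k.+1 takes the
   parameter a k. Only finitely many of the a k occur in phi(x, a). *)
Definition pformula : Type := formula L * (nat -> G).

Definition psat (q : pformula) (x : G) : Prop :=
  sat (fun k => if k is k'.+1 then q.2 k' else x) q.1.

Definition over (A : set G) (p : set pformula) : Prop :=
  forall q, p q -> forall k, A (q.2 k).

Definition realizations (p : set pformula) : set G :=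
  [set x | forall q, p q -> psat q x].

Definition finitely_satisfiable (p : set pformula) : Prop :=
  forall q, finite_set q -> q `<=` p -> realizations q !=set0.

(* |I|^+-saturation: types over at most |I| parameters are realized. *)
Definition saturated (I : Type) : Prop :=
  forall A : set G, A #<= [set: I] ->
  forall p, over A p -> finitely_satisfiable p -> realizations p !=set0.

Definition type_definable_over (A H : set G) : Prop :=
  exists2 p, over A p & H = realizations p.

Definition bounded_type_definable_subgroup (I : Type) (A H : set G) : Prop :=
  [/\ is_subgroup H, type_definable_over A H & left_cosets H #<= [set: I]].

(* H is the component G^00_A, with "bounded" meaning "at most |I|". *)
Definition is_component00 (I : Type) (A H : set G) : Prop :=
  bounded_type_definable_subgroup I A H /\
  forall H', bounded_type_definable_subgroup I A H' -> H `<=` H'.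

End Semantics.

Definition elementary (L : language) (G G' : groupType)
    (E : expansion L G) (E' : expansion L G') (e : G -> G') : Prop :=
  forall (v : nat -> G) (phi : formula L),
    sat E v phi <-> sat E' (e \o v) phi.

(* A type of cardinality 2^(|L| + |G| + aleph_0). *)
Definition bound (L : language) (G : Type) : Type :=
  set (G + fsym L + rsym L + nat).

(* With mu := 2^(|L| + |G| + aleph_0), "sufficiently saturated" is
   mu^+-saturated and "bounded index" is index < mu^+, i.e. at most mu.
   Any structure elementarily equivalent to an expansion of a group is an
   expansion of a group, so it is harmless that G' is a groupType. *)
Definition type_absolutely_connected (G : groupType) : Prop :=
  forall (L : language) (E : expansion L G)
         (G' : groupType) (E' : expansion L G') (e : G -> G'),
    elementary E E' e -> saturated E' (bound L G) ->
    is_component00 E' (bound L G) (range e) [set: G'].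

Definition tac_subgroup (G : groupType) (H : set G) : Prop :=
  exists Hsub : is_subgroup H, type_absolutely_connected (subgroup_type Hsub).

Definition largest_tac_subgroup (G : groupType) (H : set G) : Prop :=
  tac_subgroup H /\ forall H', tac_subgroup H' -> H' `<=` H.

Definition tc_radical (G : groupType) : set G :=
  xget set0 [set H : set G | largest_tac_subgroup H].
Arguments tc_radical : clear implicits.

(* Main.v *)
(** A hom from G to a compact Hausdorff group K gives, in a saturated elementary
    extension G' of G with all subsets named, the bounded type-definable subgroup
    of those x that lie in the nonstandard preimage of every neighbourhood of 1;
    it is all of G' only if the hom is trivial. Saturated extensions are built
    from an inductive type of names, by extending an ultrafilter on valuations
    of the names one name at a time (Zorn).

    Conversely let H be a bounded type-definable subgroup of G'. By saturation
    the definable sets D containing H satisfy: D contains D'^-1 D' for some D',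
    and finitely many translates of D cover G'. Hence the normal cores
    {x | x^g in D for all g} are still finitely covering, and they form a basis
    at 1 of a group topology on G' whose Hausdorff quotient is compact, again by
    saturation. G maps onto a dense subgroup of it, so when all compact images of
    G are trivial every D contains G, hence equals G' by elementarity. *)

Require Import Defs.
From HB Require Import structures.
From mathcomp Require Import all_boot.
From mathcomp Require Import monoid.
From mathcomp Require Import boolp classical_sets functions cardinality filter.
From mathcomp Require Import topology generic_quotient.

Set Implicit Arguments.
Unset Strict Implicit.
Unset Printing Implicit Defensive.

Local Open Scope classical_set_scope.
Local Open Scope card_scope.
Local Open Scope group_scope.

Local Notation eval := Defs.eval.

(** * Finite intersections in filters and ultrafilters *)

Lemma finite_set_ind (T : Type) (P : set T -> Prop) :
  P set0 -> (forall x A, P A -> P (x |` A)) ->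
  forall A, finite_set A -> P A.
Proof.
move=> P0 PU A /(@finite_seqP {classic T})[s ->]; elim: s => [|x s IHs].
  by rewrite set_nil.
rewrite (_ : [set` _] = x |` [set` s]); first exact: PU.
by apply/seteqP; split=> y /=; rewrite in_cons => /predU1P.
Qed.

Lemma filter_finite_bigI (T I : Type) (F : set_system T) (D : set I)
    (f : I -> set T) :
  Filter F -> finite_set D -> (forall i, D i -> F (f i)) ->
  F [set x | forall i, D i -> f i x].
Proof.
move=> FF finD; elim/finite_set_ind: D / finD => [|i D IH] DF.
  by apply: filterS filterT => x _ i [].
have Fi : F (f i) by apply: DF; left.
have /IH FD : forall j, D j -> F (f j) by move=> j Dj; apply: DF; right.
by apply: filterS (filterI Fi FD) => x [fi fD] j [->//|]; exact: fD.
Qed.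

(** The sets that contain some [X] in [B] cut by finitely many [A i] form a proper filter, and any
    ultrafilter above it will do. In use, [B] is what has been decided already and the [A i] are new
    demands. *)
Lemma ultra_extension (T I : Type) (B : set_system T) (P : set I)
    (A : I -> set T) :
  B setT -> setI_closed B ->
  (forall X q, B X -> finite_set q -> q `<=` P ->
    exists2 v, X v & forall i, q i -> A i v) ->
  exists U, [/\ UltraFilter U, B `<=` U & forall i, P i -> U (A i)].
Proof.
move=> BT BI fip.
pose F : set_system T := [set C | exists X q,
  [/\ B X, finite_set q, q `<=` P &
      forall v, X v -> (forall i, q i -> A i v) -> C v]].
have FF : ProperFilter F.
  split; first by move=> [X [q [BX fq qP XC]]]; have [v /XC] := fip X q BX fq qP; exact.
  split; first by exists setT, set0; split.
    move=> C C' [X [q [BX fq qP XC]]] [X' [q' [BX' fq' qP' XC']]].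
    exists (X `&` X'), (q `|` q'); split; first exact: BI.
    - by rewrite finite_setU.
    - by move=> i [/qP|/qP'].
    - move=> v [Xv X'v] qv; split; [apply: XC => // i qi|apply: XC' => // i qi].
      + by apply: qv; left.
      + by apply: qv; right.
  move=> C C' CC' [X [q [BX fq qP XC]]]; exists X, q; split=> // v Xv qv.
  exact/CC'/XC.
have [U [UU FU]] := ultraFilterLemma FF; exists U; split=> //.
  by move=> X BX; apply: FU; exists X, set0; split.
move=> i Pi; apply: FU; exists setT, [set i]; split=> //; first by move=> _ ->.
by move=> v _; exact.
Qed.

Lemma ultra_complement (T : Type) (U : set_system T) (A : set T) :
  UltraFilter U -> ~ U A -> U (~` A).
Proof. by move=> UU nA; case: (in_ultra_setVsetC A UU). Qed.

Lemma ultra_disjoint (T : Type) (U : set_system T) (A : set T) :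
  UltraFilter U -> U A -> ~ U (~` A).
Proof.
move=> UU UA UnA; have [x []] := filter_ex (filterI UA UnA); exact.
Qed.

Definition scons (T : Type) (x : T) (a : nat -> T) (k : nat) : T :=
  if k is k'.+1 then a k' else x.

(** * Saturated elementary extensions *)

Section Names.
Variables (G : groupType) (J : Type).

(* Names for the elements of a saturated elementary extension of G: a base
   name stands for an element of G, and [nwit p t] for a realization of the
   type p whose parameters are named by t. Since J is the arity of [nwit],
   every J-indexed family of names is again the parameter family of a name, so
   no chain of regular length is needed. *)
Inductive name : Type :=
| nbase of G
| nwit of set (set (nat -> G) * (nat -> J)) & (J -> name).

HB.instance Definition _ := gen_eqMixin name.
HB.instance Definition _ := gen_choiceMixin name.

Local Notation valuation := (name -> G).

(** A semantic stand-in for a formula. Types are made of such sets, so one extension serves every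
    expansion of [G]. *)
Definition finitary (X : set (nat -> G)) : Prop :=
  exists N, forall u w, (forall i, i < N -> u i = w i) -> X u -> X w.

(** Such sets act as the statements about names in [S]; a partial construction commits itself only
    on them. *)
Definition supported (S : set name) (B : set valuation) : Prop :=
  exists2 s : seq name, (forall n, n \in s -> S n) &
    forall u w, {in s, u =1 w} -> B u -> B w.

Lemma supportedT S : supported S setT.
Proof. by exists [::]. Qed.

Lemma supportedI S B C : supported S B -> supported S C -> supported S (B `&` C).
Proof.
move=> [s sS sB] [t tS tC]; exists (s ++ t).
  by move=> n; rewrite mem_cat => /orP[/sS|/tS].
move=> u w uw [Bu Cu]; split.
  by apply: sB Bu => n ns; apply: uw; rewrite mem_cat ns.
by apply: tC Cu => n nt; apply: uw; rewrite mem_cat nt orbT.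
Qed.

Lemma supportedC S B : supported S B -> supported S (~` B).
Proof.
move=> [s sS sB]; exists s => // u w uw nBu Bw; apply: nBu.
by apply: sB Bw => n ns; rewrite uw.
Qed.

Lemma supported_sub S S' B : S `<=` S' -> supported S B -> supported S' B.
Proof. by move=> SS' [s sS sB]; exists s => // n /sS/SS'. Qed.

Lemma supported_base (S : set name) g : S (nbase g) ->
  supported S [set v | v (nbase g) = g].
Proof.
move=> Sg; exists [:: nbase g].
  by move=> n; rewrite mem_seq1 => /eqP->.
by move=> u w uw /=; rewrite uw ?mem_head.
Qed.

Lemma finitary_seq (X : set (nat -> G)) (a : nat -> name) : finitary X ->
  exists2 s : seq name, (forall n, n \in s -> exists k, n = a k) &
    forall u w x, {in s, u =1 w} -> X (scons x (u \o a)) -> X (scons x (w \o a)).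
Proof.
move=> [N XN]; exists [seq a k | k <- iota 0 N].
  by move=> n /mapP[k _ ->]; exists k.
move=> u w x uw; apply: XN => -[//|i] iN /=; apply: uw.
by apply: map_f; rewrite mem_iota /= add0n; exact: ltnW.
Qed.

Section WitSupport.
Variables (S : set name) (t : J -> name).
Hypothesis tS : forall j, S (t j).

Lemma supported_fsat (q : set (set (nat -> G) * (nat -> J))) :
  finite_set q -> (forall c, q c -> finitary c.1) ->
  supported S [set v : valuation | exists x, forall c, q c -> c.1 (scons x (v \o t \o c.2))].
Proof.
move=> fq finq.
(* The support must work for all [x] at once, since the witness is bound inside the set. *)
suff [s sS sq] : exists2 s : seq name, (forall n, n \in s -> S n) &
    forall u w x c, {in s, u =1 w} -> q c ->
      c.1 (scons x (u \o t \o c.2)) -> c.1 (scons x (w \o t \o c.2)).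
  exists s => // u w uw [x xq]; exists x => c qc.
  exact: (sq u w x c uw qc (xq _ qc)).
elim/finite_set_ind: q / fq finq => [|c q IH] finq; first by exists [::].
have [|s sS sq] := IH; first by move=> d qd; apply: finq; right.
have [|s' s'S s'q] := @finitary_seq c.1 (t \o c.2); first by apply: finq; left.
exists (s ++ s').
  by move=> n; rewrite mem_cat => /orP[/sS|/s'S[k ->]]//; exact: tS.
move=> u w x d uw [->|qd].
  by apply: s'q => n ns; apply: uw; rewrite mem_cat ns orbT.
by apply: sq => // n ns; apply: uw; rewrite mem_cat ns.
Qed.

Lemma supported_sat n (X : set (nat -> G)) a : S n -> finitary X ->
  supported S [set v : valuation | X (scons (v n) (v \o t \o a))].
Proof.
move=> Sn /(@finitary_seq X (t \o a))[s sS sX]; exists (n :: s).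
  by move=> m; rewrite in_cons => /orP[/eqP->|/sS[k ->]]//; exact: tS.
move=> u w uw /=; rewrite (uw n) ?mem_head//; apply: sX => m ms; apply: uw.
by rewrite in_cons ms orbT.
Qed.

End WitSupport.

(** The two premises make the clause vacuous unless [p] consists of finitary sets and is finitely
    satisfiable modulo [U]; so every pair [(p, t)] may be a name. *)
Definition realizes (U : set_system valuation) p (t : J -> name) : Prop :=
  (forall c, p c -> finitary c.1) ->
  (forall q, finite_set q -> q `<=` p ->
    U [set v : valuation | exists x, forall c, q c -> c.1 (scons x (v \o t \o c.2))]) ->
  forall c, p c -> U [set v : valuation | c.1 (scons (v (nwit p t)) (v \o t \o c.2))].

(** One inclusion is enough: supported sets are closed under complement, and an ultrafilter contains
    a set or its complement. *)
Lemma supported_agree (U U' : set_system valuation) S B :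
  UltraFilter U -> UltraFilter U' ->
  (forall C, supported S C -> U C -> U' C) -> supported S B -> U' B -> U B.
Proof.
move=> UU UU' agree sB U'B; apply: contrapT => nUB.
apply: (ultra_disjoint UU' U'B).
exact: agree (supportedC sB) (ultra_complement UU nUB).
Qed.

Lemma realizes_agree (U U' : set_system valuation) S p t :
  UltraFilter U -> UltraFilter U' -> (forall j, S (t j)) -> S (nwit p t) ->
  (forall C, supported S C -> U C -> U' C) -> realizes U p t -> realizes U' p t.
Proof.
move=> UU UU' tS nS agree Upt finp satp c pc; apply: (agree).
  by apply: supported_sat => //; exact: finp.
apply: Upt => // q fq qp; apply: (supported_agree _ _ agree) => //.
  by apply: supported_fsat => // d /qp; exact: finp.
exact: satp.
Qed.

(** A partial construction that has dealt with the names in [dom]. Though [ult] is an ultrafilter on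
    all valuations, [stage_le] retains only its trace on the sets supported in [dom]. *)
Record stage : Type := Stage {
  dom : set name;
  ult : set_system valuation;
  ult_ultra : UltraFilter ult;
  dom_down : forall p t, dom (nwit p t) -> forall j, dom (t j);
  dom_base : forall g, dom (nbase g) -> ult [set v : valuation | v (nbase g) = g];
  dom_wit : forall p t, dom (nwit p t) -> realizes ult p t
}.

Definition stage_le (s s' : stage) : Prop :=
  dom s `<=` dom s' /\
  forall B, supported (dom s) B -> ult s B -> ult s' B.

Definition decided (s : stage) : set_system valuation :=
  [set B | supported (dom s) B /\ ult s B].

Lemma decidedT s : decided s setT.
Proof. by split; [exact: supportedT|have := ult_ultra s => ?; exact: filterT]. Qed.

Lemma decidedI s : setI_closed (decided s).
Proof.
move=> B C [sB uB] [sC uC]; split; first exact: supportedI.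
by have := ult_ultra s => ?; exact: filterI.
Qed.

(** The clauses for earlier names survive because they concern sets supported in [dom s], on which
    [U] agrees with [ult s]; only the clause for [n] has to be supplied. *)
Lemma stage_add s n U : ~ dom s n -> UltraFilter U -> decided s `<=` U ->
  (forall g, n = nbase g -> U [set v : valuation | v n = g]) ->
  (forall p t, n = nwit p t -> (forall j, dom s (t j)) /\ realizes U p t) ->
  exists2 s', stage_le s s' & dom s' n.
Proof.
move=> sn UU sU nb nw; have us := ult_ultra s.
have down p t : (n |` dom s) (nwit p t) -> forall j, (n |` dom s) (t j).
  move=> [ntE j|/dom_down st j]; last by right; exact: st.
  by right; case: (nw p t); [rewrite -ntE|].
have base g : (n |` dom s) (nbase g) -> U [set v : valuation | v (nbase g) = g].
  move=> [ngE|sg]; first by rewrite ngE; exact: nb.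
  by apply: sU; split; [exact: supported_base|exact: dom_base].
have wit p t : (n |` dom s) (nwit p t) -> realizes U p t.
  move=> [ntE|spt]; first by case: (nw p t); rewrite -?ntE.
  apply: (realizes_agree us UU (dom_down spt) spt _ (dom_wit spt)).
  by move=> C sC uC; exact: sU.
exists (Stage UU down base wit); last by left.
by split=> [m sm|B sB uB]; [right|exact: sU].
Qed.

Lemma stage_add_base s g : ~ dom s (nbase g) ->
  exists2 s', stage_le s s' & dom s' (nbase g).
Proof.
move=> sn; have us := ult_ultra s.
have [|U [UU sU Ug]] := @ultra_extension _ unit (decided s) setT
  (fun=> [set v : valuation | v (nbase g) = g]) (decidedT s) (@decidedI s).
  move=> X q [[l ls lX] uX] _ _; have [v Xv] := filter_ex uX.
  (* Changing [v] at a name outside [dom s] does not lead out of [X], which is supported in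
     [dom s]. *)
  exists (fun m => if m == nbase g then g else v m); last by move=> _ _ /=; rewrite eqxx.
  by apply: lX Xv => m /ls; case: eqP => // ->.
by apply: (stage_add sn UU sU) => // h [<-]; exact: (Ug tt).
Qed.

Lemma stage_add_wit s p t : (forall j, dom s (t j)) -> ~ dom s (nwit p t) ->
  exists2 s', stage_le s s' & dom s' (nwit p t).
Proof.
move=> ts sn; have us := ult_ultra s.
(* If [ok] fails, the family of demands is empty and the new name is unconstrained. *)
pose ok := (forall c, p c -> finitary c.1) /\
  (forall q, finite_set q -> q `<=` p ->
    ult s [set v : valuation | exists x, forall c, q c -> c.1 (scons x (v \o t \o c.2))]).
have [|U [UU sU Up]] := @ultra_extension _ _ (decided s) [set c | p c /\ ok]
  (fun c => [set v : valuation | c.1 (scons (v (nwit p t)) (v \o t \o c.2))])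
  (decidedT s) (@decidedI s).
  move=> X q [[l ls lX] uX] fq qp.
  have [q0|/set0P[c0 /qp[_ [_ okp]]]] := eqVneq q set0.
    by have [v Xv] := filter_ex uX; exists v => // c; rewrite q0.
  have /(okp _ fq)/(filterI uX)/filter_ex[v [Xv [x xq]]] : q `<=` p.
    by move=> c /qp[].
  (* The new name receives a realization [x] of the finite part [q]; the parameter names lie in
     [dom s] and keep their values. *)
  pose w m := if m == nwit p t then x else v m.
  have wv m : dom s m -> w m = v m by rewrite /w; case: eqP => // ->.
  exists w; first by apply: lX Xv => m /ls/wv.
  move=> c qc /=; rewrite {1}/w eqxx.
  rewrite (_ : w \o t \o c.2 = v \o t \o c.2); first exact: xq.
  by apply/funext => k /=; rewrite wv.
apply: (stage_add sn UU sU) => // _ _ [<- <-]; split=> // finp satp c pc.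
apply: Up; split=> //; split=> // q fq qp.
apply: (@supported_agree (ult s) U (dom s)) => //.
- by move=> C sC uC; exact: sU.
- by apply: supported_fsat => // d /qp; exact: finp.
- exact: satp.
Qed.

Lemma stage0 : inhabited stage.
Proof.
have [||U [UU _ _]] := @ultra_extension valuation void [set setT] set0 (fun=> setT) erefl.
- by move=> _ _ -> ->; rewrite setIT.
- by move=> X q -> _ q0; exists (fun=> 1) => // i /q0.
by constructor; apply: (@Stage set0 U UU).
Qed.

(** The ultrafilters of a chain need not be nested, but the sets decided at some stage are closed
    under intersection; a fresh ultrafilter is taken above them. *)
Lemma stage_chain (A : set stage) :
  total_on A stage_le -> exists s, forall s', A s' -> stage_le s' s.
Proof.
move=> totA; have [A0|/set0P[s0 As0]] := eqVneq A set0.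
  by have [s] := stage0; exists s => s'; rewrite A0.
pose B : set_system valuation := \bigcup_(s in A) decided s.
have BI : setI_closed B.
  move=> X Y [s As [sX uX]] [s' As' [sY uY]].
  case: (totA _ _ As As') => -[sub le]; [exists s' => //|exists s => //]; apply: decidedI.
  - by split; [exact: supported_sub sX|exact: le].
  - by split.
  - by split.
  - by split; [exact: supported_sub sY|exact: le].
have [| |U [UU BU _]] := @ultra_extension valuation void B set0 (fun=> setT) _ BI.
- by exists s0 => //; exact: decidedT.
- move=> X q [s _ [_ uX]] _ _; have := ult_ultra s => us.
  by have [v Xv] := filter_ex uX; exists v.
have agree s C : A s -> supported (dom s) C -> ult s C -> U C.
  by move=> As sC uC; apply: BU; exists s.
pose D := \bigcup_(s in A) dom s.
have down p t : D (nwit p t) -> forall j, D (t j).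
  by move=> [s As spt] j; exists s => //; exact: dom_down spt j.
have base g : D (nbase g) -> U [set v : valuation | v (nbase g) = g].
  move=> [s As sg]; apply: (agree s) => //; last exact: dom_base.
  exact: supported_base.
have wit p t : D (nwit p t) -> realizes U p t.
  move=> [s As spt]; have us := ult_ultra s.
  by apply: (realizes_agree us UU (dom_down spt) spt _ (dom_wit spt)) => C; exact: agree.
exists (Stage UU down base wit) => s As; split=> [n sn|C]; first by exists s.
exact: agree.
Qed.

Lemma saturated_ultrafilter : exists U : set_system valuation,
  [/\ UltraFilter U, forall g, U [set v : valuation | v (nbase g) = g] &
      forall p t, realizes U p t].
Proof.
have [s0] := stage0.
have [|||s smax] := @ZL_preorder _ s0 (fun s s' => `[< stage_le s s' >]).
- by move=> s; apply/asboolP; split.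
- move=> s s' s'' /asboolP[sub1 le1] /asboolP[sub2 le2]; apply/asboolP; split.
    exact: subset_trans sub1 sub2.
  by move=> B sB uB; apply: le2; [exact: supported_sub sB|exact: le1].
- move=> A totA; have [|s sA] := @stage_chain A.
    by move=> s s' As As'; case: (totA s s' As As') => /asboolP; [left|right].
  by exists s => s' As'; apply/asboolP; exact: sA.
have max n s' : stage_le s s' -> dom s' n -> dom s n.
  by move=> ss'; have /asboolP[+ _] := smax s' (introT (asboolP _) ss'); exact.
(* Structural induction on names: the parameters of a witness are in the domain before the witness
   itself, so a maximal stage cannot miss it. *)
have sT n : dom s n.
  elim: n => [g|p t IH]; apply: contrapT => sn.
    by have [s' ss' s'n] := stage_add_base sn; apply/sn/(max _ _ ss').
  by have [s' ss' s'n] := stage_add_wit IH sn; apply/sn/(max _ _ ss').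
exists (ult s); split; first exact: ult_ultra.
  by move=> g; exact: dom_base.
by move=> p t; exact: dom_wit.
Qed.

End Names.

Lemma card_le_range (J T : Type) (A : set T) : A !=set0 -> A #<= [set: J] ->
  exists s : J -> T, A = range s.
Proof.
move=> [a0 Aa0] /card_leP[f].
have /choice[s sP] : forall j, exists x,
    A x /\ forall y : A, \val (f y) = j -> x = \val y.
  move=> j; have [[y yj]|ny] := pselect (exists y : A, \val (f y) = j).
    exists (\val y); split; first exact: set_valP.
    by move=> z; rewrite -yj => /val_inj/('inj_f (in_setT z) (in_setT y))->.
  by exists a0; split=> // y yj; case: ny; exists y.
exists s; apply/seteqP; split=> [x Ax|_ [j _ <-]]; last by case: (sP j).
pose y : A := SigSub (mem_set Ax); exists (\val (f y)) => //.
by have [_ /(_ y erefl)] := sP (\val (f y)).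
Qed.

(** * Formulas depend on finitely many variables *)

Section FiniteVariables.
Variables (L : language) (G : groupType) (E : expansion L G).

Lemma eval_local (t : term L) : exists N, forall u w : nat -> G,
  (forall i, i < N -> u i = w i) -> eval E u t = eval E w t.
Proof.
elim: t => [n|t [N NP] t' [N' NP']|f ts IH].
- by exists n.+1 => u w; apply.
- exists (maxn N N') => u w uw /=; congr (_ * _).
    by apply: NP => i iN; apply: uw; rewrite leq_max iN.
  by apply: NP' => i iN; apply: uw; rewrite leq_max iN orbT.
- have [N NP] := choice IH.
  exists (\max_i N i) => u w uw /=; congr finterp; apply/funext => i.
  by apply: (NP i) => k ki; apply: uw; exact: leq_trans ki (leq_bigmax i).
Qed.

Lemma sat_local (phi : formula L) : exists N, forall u w : nat -> G,
  (forall i, i < N -> u i = w i) -> sat E u phi <-> sat E w phi.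
Proof.
elim: phi => [t t'|r ts| |phi [N NP] phi' [N' NP']|n phi [N NP]].
- have [N NP] := eval_local t; have [N' NP'] := eval_local t'.
  exists (maxn N N') => u w uw /=; rewrite (NP u w) ?(NP' u w)// => i iN; apply: uw.
    by rewrite leq_max iN orbT.
  by rewrite leq_max iN.
- have [N NP] := choice (fun i => eval_local (ts i)).
  exists (\max_i N i) => u w uw /=.
  rewrite (_ : (fun i => eval E u (ts i)) = fun i => eval E w (ts i))//.
  apply/funext => i.
  by apply: (NP i) => k ki; apply: uw; exact: leq_trans ki (leq_bigmax i).
- by exists 0.
- exists (maxn N N') => u w uw /=; have [|H1 H2] := NP u w.
    by move=> i iN; apply: uw; rewrite leq_max iN.
  have [|H1' H2'] := NP' u w; last by split=> H; [move/H2/H/H1'|move/H1/H/H2'].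
  by move=> i iN; apply: uw; rewrite leq_max iN orbT.
- exists N => u w uw /=; split=> H x; have := H x; apply NP => i iN;
    by case: eqP => // _; rewrite uw.
Qed.

Lemma sat_finitary (phi : formula L) : finitary [set v | sat E v phi].
Proof. by have [N NP] := sat_local phi; exists N => u w /NP[]. Qed.

End FiniteVariables.

(** * The extension as names modulo almost sure equality *)

Section Extension.
Variables (G : groupType) (J : Type).

(** The injection [su_enc] lets countable parameter sequences fit the arity [J] of witness names. *)
Record sat_ultrafilter : Type := SatUltrafilter {
  su : set_system (name G J -> G);
  su_ultra : UltraFilter su;
  su_base : forall g, su [set v | v (nbase J g) = g];
  su_wit : forall p t, realizes su p t;
  su_enc : nat -> J;
  su_dec : J -> nat;
  su_encK : cancel su_enc su_dec
}.

Variable M : sat_ultrafilter.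
Local Notation U := (su M).
Local Notation name := (name G J).
Local Notation valuation := (name -> G).

Local Instance su_ultra_instance : UltraFilter U := su_ultra M.

(** The one-element type [Y] is satisfiable for all parameters, being vacuous when no [x] exists, so
    its witness name serves as a Skolem function for [X]. *)
Lemma henkin (X : set (nat -> G)) (a : nat -> name) : finitary X ->
  exists n, U [set v : valuation | (exists x, X (scons x (v \o a))) ->
                       X (scons (v n) (v \o a))].
Proof.
move=> [N XN].
pose Y : set (nat -> G) :=
  [set w : nat -> G | (exists x, X (scons x (w \o succn))) -> X w].
have finY : finitary Y.
  exists N.+1 => u w uw Yu [x Xx]; apply: (XN u); first by move=> i iN; apply/uw/ltnW.
  apply: Yu; exists x; apply: XN Xx => -[//|i] iN /=; rewrite uw//.
  by rewrite ltnS ltnW.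
pose t j := a (su_dec M j); pose p := [set (Y, su_enc M)].
have vta (v : valuation) : v \o t \o su_enc M = v \o a.
  by apply/funext => k /=; rewrite /t su_encK.
exists (nwit p t).
have H : U [set v : valuation | Y (scons (v (nwit p t)) (v \o t \o su_enc M))].
  apply: (@su_wit M p t _ _ (Y, su_enc M) erefl) => [_ -> //|q _ qp].
  apply: filterS filterT => v _.
  have [[x Xx]|nX] := pselect (exists x, X (scons x (v \o a))).
    by exists x => _ /qp->; rewrite /Y /= vta.
  by exists 1 => _ /qp-> /=; rewrite vta => -[x Xx]; case: nX; exists x.
apply: filterS H => v.
by rewrite -[X in X -> _]/(Y (scons (v (nwit p t)) (v \o t \o su_enc M))) vta.
Qed.

(** The Skolem name for the graph of [h]. Through it the group operations and the function symbols
    are computed valuation by valuation. *)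
Lemma fname_exists (I : finType) (xs : I -> name) (h : (I -> G) -> G) :
  exists k, U [set v : valuation | v k = h (fun i => v (xs i))].
Proof.
pose a k := nth (nbase J 1) [seq xs i | i <- enum I] k.
pose X : set (nat -> G) := [set w | w 0 = h (fun i => w (enum_rank i).+1)].
have [|k kX] := @henkin X a.
  exists #|I|.+1 => u w uw; rewrite /X /= uw// => ->; congr h.
  by apply/funext => i; rewrite uw// ltnS ltn_ord.
have aE i : a (enum_rank i) = xs i.
  by rewrite /a (nth_map i) ?nth_enum_rank// -cardE ltn_ord.
exists k; apply: filterS kX => v vk.
have hE : (fun i => v (a (enum_rank i))) = (fun i => v (xs i)).
  by apply/funext => i; rewrite aE.
have /vk : exists x, X (scons x (v \o a)).
  by exists (h (fun i => v (xs i))); rewrite /X /= hE.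
by rewrite /X /= hE.
Qed.

Definition fname (I : finType) (xs : I -> name) (h : (I -> G) -> G) : name :=
  sval (cid (fname_exists xs h)).

Lemma fnameP (I : finType) (xs : I -> name) (h : (I -> G) -> G) :
  U [set v : valuation | v (fname xs h) = h (fun i => v (xs i))].
Proof. exact: (svalP (cid (fname_exists xs h))). Qed.

Definition name_eq (n m : name) : bool := `[< U [set v : valuation | v n = v m] >].

Lemma name_eq_refl : reflexive name_eq.
Proof. by move=> n; apply/asboolP; apply: filterS filterT. Qed.

Lemma name_eq_sym : symmetric name_eq.
Proof. by move=> n m; apply/asboolP/asboolP; apply: filterS => v /= ->. Qed.

Lemma name_eq_trans : transitive name_eq.
Proof.
move=> m n k /asboolP nm /asboolP mk; apply/asboolP.
by apply: filterS (filterI nm mk) => v [/= -> ->].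
Qed.

Definition name_equiv : equiv_rel name :=
  EquivRel name_eq name_eq_refl name_eq_sym name_eq_trans.

Definition extension : Type := {eq_quot name_equiv}%qT.
HB.instance Definition _ := Choice.copy extension {eq_quot name_equiv}%qT.

Definition elt (n : name) : extension := \pi_({eq_quot name_equiv})%qT n.
Definition elt_name (x : extension) : name := repr (x : {eq_quot name_equiv}%qT).

Lemma elt_nameK x : elt (elt_name x) = x.
Proof. exact: reprK. Qed.

Lemma eltP n m : elt n = elt m <-> U [set v : valuation | v n = v m].
Proof.
split=> [/eqP|H]; first by rewrite eqmodE => /asboolP.
by apply/eqP; rewrite eqmodE; apply/asboolP.
Qed.

Lemma elt_nameP n : U [set v : valuation | v (elt_name (elt n)) = v n].
Proof. by apply/eltP; rewrite elt_nameK. Qed.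

Definition ext_mul (x y : extension) : extension :=
  elt (fname (fun b => elt_name (if b then x else y)) (fun z => z true * z false)).
Definition ext_inv (x : extension) : extension :=
  elt (fname (fun _ : unit => elt_name x) (fun z => (z tt)^-1)).
Definition ext_one : extension := elt (nbase J 1).

Lemma ext_mulP n m : exists2 k, ext_mul (elt n) (elt m) = elt k &
  U [set v : valuation | v k = v n * v m].
Proof.
pose xs b := elt_name (if b then elt n else elt m).
pose h (z : bool -> G) := z true * z false.
exists (fname xs h) => //.
apply: filterS (filterI (fnameP xs h) (filterI (elt_nameP n) (elt_nameP m))).
by move=> v [/= -> [+ +]]; rewrite /h /= => -> ->.
Qed.

Lemma ext_invP n : exists2 k, ext_inv (elt n) = elt k & U [set v : valuation | v k = (v n)^-1].
Proof.
pose xs (_ : unit) := elt_name (elt n); pose h (z : unit -> G) := (z tt)^-1.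
exists (fname xs h) => //.
apply: filterS (filterI (fnameP xs h) (elt_nameP n)).
by move=> v [/= -> +]; rewrite /h /= => ->.
Qed.

Lemma ext_mulA : associative ext_mul.
Proof.
move=> x y z; rewrite -(elt_nameK x) -(elt_nameK y) -(elt_nameK z).
set n := elt_name x; set m := elt_name y; set k := elt_name z.
have [a -> aP] := ext_mulP m k; have [b -> bP] := ext_mulP n a.
have [c -> cP] := ext_mulP n m; have [d -> dP] := ext_mulP c k.
apply/eltP; apply: filterS (filterI (filterI aP bP) (filterI cP dP)).
by move=> v [[/= -> ->] [-> ->]]; rewrite mulgA.
Qed.

Lemma ext_mul1 : left_id ext_one ext_mul.
Proof.
move=> x; rewrite -(elt_nameK x) /ext_one; set n := elt_name x.
have [a -> aP] := ext_mulP (nbase J 1) n.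
apply/eltP; apply: filterS (filterI aP (su_base M 1)).
by move=> v [/= -> ->]; rewrite mul1g.
Qed.

Lemma ext_mulr1 : right_id ext_one ext_mul.
Proof.
move=> x; rewrite -(elt_nameK x) /ext_one; set n := elt_name x.
have [a -> aP] := ext_mulP n (nbase J 1).
apply/eltP; apply: filterS (filterI aP (su_base M 1)).
by move=> v [/= -> ->]; rewrite mulg1.
Qed.

Lemma ext_mulV : left_inverse ext_one ext_inv ext_mul.
Proof.
move=> x; rewrite -(elt_nameK x) /ext_one; set n := elt_name x.
have [a -> aP] := ext_invP n; have [b -> bP] := ext_mulP a n.
apply/eltP; apply: filterS (filterI (filterI aP bP) (su_base M 1)).
by move=> v [[/= -> ->] ->]; rewrite mulVg.
Qed.

Lemma ext_mulrV : right_inverse ext_one ext_inv ext_mul.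
Proof.
move=> x; rewrite -(elt_nameK x) /ext_one; set n := elt_name x.
have [a -> aP] := ext_invP n; have [b -> bP] := ext_mulP n a.
apply/eltP; apply: filterS (filterI (filterI aP bP) (su_base M 1)).
by move=> v [[/= -> ->] ->]; rewrite mulgV.
Qed.

HB.instance Definition _ := isGroup.Build extension
  ext_mulA ext_mul1 ext_mulr1 ext_mulV ext_mulrV.

Variables (L : language) (E : expansion L G).

Definition ext_expansion : expansion L extension :=
  @Expansion L extension
    (fun f xs => elt (fname (fun i => elt_name (xs i)) (@finterp L G E f)))
    (fun r xs => U [set v : valuation | rinterp E (fun i => v (elt_name (xs i)))]).

Lemma filter_elt_names (I : finType) (ks : I -> name) :
  U [set v : valuation | (fun i => v (elt_name (elt (ks i)))) = (fun i => v (ks i))].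
Proof.
apply: filterS (filter_forall _ (fun i => elt_nameP (ks i))) => v vP.
by apply/funext => i; exact: vP.
Qed.

Lemma los_eval (a : nat -> name) (t : term L) : exists2 k,
  eval ext_expansion (elt \o a) t = elt k & U [set v : valuation | eval E (v \o a) t = v k].
Proof.
elim: t => [n|t [k tE kP] t' [k' t'E kP']|f ts IH] /=.
- by exists (a n) => //; apply: filterS filterT.
- have [m mE mP] := ext_mulP k k'; exists m; first by rewrite tE t'E.
  by apply: filterS (filterI mP (filterI kP kP')) => v [/= -> [-> ->]].
- have {}IH i : exists k, eval ext_expansion (elt \o a) (ts i) = elt k /\
      U [set v : valuation | eval E (v \o a) (ts i) = v k].
    by have [k ? ?] := IH i; exists k.
  have [ks ksP] := choice IH.
  pose xs i := elt_name (elt (ks i)); exists (fname xs (@finterp L G E f)).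
    congr (elt (fname _ _)); apply/funext => i.
    by rewrite /xs; case: (ksP i) => ->.
  have H : U [set v : valuation | forall i, eval E (v \o a) (ts i) = v (ks i)].
    exact: filter_forall _ (fun i => (ksP i).2).
  apply: filterS (filterI (fnameP xs (@finterp L G E f)) (filterI (filter_elt_names ks) H)).
  move=> v [/= -> [+ vH]]; rewrite /xs => ->; congr finterp; apply/funext => i.
  by exact: vH.
Qed.

(** The theorem of Los. In the quantifier case a possible counterexample is named by [henkin], where
    an ultrapower would choose a function. *)
Lemma los (phi : formula L) (a : nat -> name) :
  sat ext_expansion (elt \o a) phi <-> U [set v : valuation | sat E (v \o a) phi].
Proof.
elim: phi a => [t t'|r ts| |phi IH phi' IH'|n phi IH] a /=.
- have [k -> kP] := los_eval a t; have [k' -> kP'] := los_eval a t'.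
  split=> [/eltP|] H; last apply/eltP.
    by apply: filterS (filterI H (filterI kP kP')) => v [/= + [-> ->]].
  by apply: filterS (filterI H (filterI kP kP')) => v [/= + [<- <-]].
- have IH i : exists k, eval ext_expansion (elt \o a) (ts i) = elt k /\
      U [set v : valuation | eval E (v \o a) (ts i) = v k].
    by have [k ? ?] := los_eval a (ts i); exists k.
  have [ks ksP] := choice IH.
  have H : U [set v : valuation | forall i, eval E (v \o a) (ts i) = v (ks i)].
    exact: filter_forall _ (fun i => (ksP i).2).
  have {}H : U [set v : valuation | (fun i => eval E (v \o a) (ts i)) = (fun i => v (ks i))].
    by apply: filterS H => v vH; apply/funext => i; exact: vH.
  have H2 : U [set v : valuation |
      (fun i => v (elt_name (eval ext_expansion (elt \o a) (ts i)))) = (fun i => v (ks i))].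
    apply: filterS (filter_elt_names ks) => v /= <-.
    by apply/funext => i; rewrite (ksP i).1.
  rewrite -[X in X <-> _]/(U [set v : valuation | rinterp E
    (fun i => v (elt_name (eval ext_expansion (elt \o a) (ts i))))]).
  by split=> H'; apply: filterS (filterI (filterI H H2) H') => v [[/= -> ->]].
- by split=> // H; have [] := filter_ex H.
- split=> [H|H /IH H'].
    have [/IH/H/IH' H'|nH] := pselect (U [set v : valuation | sat E (v \o a) phi]).
      by apply: filterS H' => v /=.
    by apply: filterS (ultra_complement _ nH) => v /= nv /nv.
  by apply/IH'; apply: filterS (filterI H H') => v [/= H1 /H1].
- have updE (k : name) : (fun i => if i == n then elt k else (elt \o a) i) =
      elt \o (fun i => if i == n then k else a i).
    by apply/funext => i /=; case: eqP.
  have updv (v : valuation) (k : name) :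
      v \o (fun i => if i == n then k else a i) =
      (fun i => if i == n then v k else (v \o a) i).
    by apply/funext => i /=; case: eqP.
  split=> [H|H x].
    (* Coordinate 0 holds the tested value of variable [n]; the old valuation is shifted up by
       one. *)
    pose X : set (nat -> G) :=
      [set w | ~ sat E (fun i => if i == n then w 0 else w i.+1) phi].
    have [|k kX] := @henkin X a.
      have [N NP] := sat_local E phi; exists N.+1 => u w uw nu sw; apply: nu.
      by move: sw; apply NP => i iN; case: eqP => _; rewrite uw.
    have := H (elt k); rewrite updE => /IH H'.
    apply: filterS (filterI kX H') => v [/= vk]; rewrite updv => sk x.
    apply: contrapT => nx; apply: vk sk; by exists x.
  rewrite -(elt_nameK x) updE; apply/IH; apply: filterS H => v /=.
  by rewrite updv.
Qed.

Definition ext_embed (g : G) : extension := elt (nbase J g).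

Lemma ext_embed_elementary : elementary E ext_expansion ext_embed.
Proof.
move=> v phi; rewrite (_ : ext_embed \o v = elt \o (@nbase G J \o v))//.
rewrite (los phi); have [N NP] := sat_local E phi.
(* Only finitely many base names can be fixed simultaneously, whence the bound [N] on the variables
   of [phi]. *)
have H : U [set w | forall i : 'I_N, w (nbase J (v i)) = v i].
  exact: filter_forall _ (fun i : 'I_N => su_base M (v i)).
split=> H'.
  apply: filterS H => w wH /=; move: H'; apply NP => i iN /=.
  by rewrite (wH (Ordinal iN)).
have [w [wH]] := filter_ex (filterI H H'); apply NP => i iN /=.
by rewrite (wH (Ordinal iN)).
Qed.

(** The parameter set is enumerated by [J], which turns the type into a set [p'] of finitary sets
    with parameters named by [t]; the name [nwit p' t] then realizes it. *)
Lemma ext_saturated : saturated ext_expansion J.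
Proof.
move=> A AJ p pA psat.
(* The empty type is realized by 1; a member of a nonempty one provides a parameter, so that [A] can
   be enumerated by [J]. *)
have [[q0 pq0]|p0] := pselect (exists q0, p q0); last first.
  by exists 1 => q pq; case: p0; exists q.
have A0 : A !=set0 by exists (q0.2 0); exact: pA.
have [s AE] := card_le_range A0 AJ.
pose t j := elt_name (s j).
pose p' : set (set (nat -> G) * (nat -> J)) := [set c | exists q,
  [/\ p q, c.1 = [set v | sat E v q.1] & forall k, s (c.2 k) = q.2 k]].
pose n := nwit p' t.
have psatE (q : pformula L extension) (b : nat -> J) m : (forall k, s (b k) = q.2 k) ->
    Defs.psat ext_expansion q (elt m) <->
    U [set v : valuation | sat E (scons (v m) (v \o t \o b)) q.1].
  move=> sb; rewrite /Defs.psat.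
  have -> : (fun k => if k is k'.+1 then q.2 k' else elt m) = elt \o scons m (t \o b).
    by apply/funext => -[//|k] /=; rewrite /t elt_nameK.
  rewrite los; suff H (v : valuation) : v \o scons m (t \o b) = scons (v m) (v \o t \o b).
    by split; apply: filterS => v /=; rewrite H.
  by apply/funext => -[].
exists (elt n) => q pq.
have /choice[b sb] : forall k, exists j, s j = q.2 k.
  by move=> k; have := pA q pq k; rewrite AE => -[j _ <-]; exists j.
apply/(psatE q b) => //.
apply: (@su_wit M p' t _ _ ([set v | sat E v q.1], b)); last by exists q.
  by move=> c [r [_ -> _]]; exact: sat_finitary.
move=> q' fq' q'p'.
have /choice[r rP] : forall c, exists r, p' c ->
  [/\ p r, c.1 = [set v | sat E v r.1] & forall k, s (c.2 k) = r.2 k].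
  move=> c; have [[r H]|nc] := pselect (p' c); first by exists r.
  by exists q0.
have [|z|x xP] := psat [set r c | c in q'].
- exact: finite_image.
- by move=> [c /q'p'/rP[pc _ _] <-].
have H c : q' c -> U [set v : valuation | c.1 (scons (v (elt_name x)) (v \o t \o c.2))].
  move=> q'c; have [_ -> sc] := rP _ (q'p' _ q'c).
  apply/(psatE (r c)) => //; rewrite elt_nameK; apply: xP.
  by exists c.
apply: filterS (filter_finite_bigI _ fq' H) => v vH.
by exists (v (elt_name x)) => c /vH.
Qed.

End Extension.

Theorem saturated_extension (L : language) (G : groupType) (E : expansion L G)
    (J : Type) (enc : nat -> J) : injective enc ->
  exists (G' : groupType) (E' : expansion L G') (e : G -> G'),
    elementary E E' e /\ saturated E' J.
Proof.
move=> encI; have [U [UU Ub Uw]] := saturated_ultrafilter G J.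
pose dec j := xget 0%N [set n | enc n = j].
have encK : cancel enc dec.
  by move=> n; apply: encI; apply: (@xgetPex _ 0%N [set m | enc m = enc n]); exists n.
pose M := SatUltrafilter UU Ub Uw encK.
exists (extension M), (ext_expansion M E), (ext_embed M).
by split; [exact: ext_embed_elementary|exact: ext_saturated].
Qed.

(** * Elementary embeddings and the expansion by all subsets *)

Section Elementary.
Variables (L : language) (G G' : groupType).
Variables (E : expansion L G) (E' : expansion L G') (e : G -> G').
Hypothesis eE : elementary E E' e.

Lemma elementaryM : {morph e : x y / x * y}.
Proof.
move=> x y; apply/esym.
have := eE (fun k => if k is k'.+1 then if k' is _.+1 then x * y else y else x)
  (fEq (tMul (tVar L 0) (tVar L 1)) (tVar L 2)).
by rewrite /= => -[+ _]; apply.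
Qed.

Lemma elementary1 : e 1 = 1.
Proof. by apply: (mulgI (e 1)); rewrite -elementaryM !mulg1. Qed.

End Elementary.

Section PredicateExpansion.
Variable G : groupType.

Definition pred_language : language :=
  @Language void (fun=> 0) (set G) (fun=> 1%N).

Definition pred_expansion : expansion pred_language G :=
  @Expansion pred_language G
    (fun f => match f with end) (fun A xs => A (xs ord0)).

Variables (G' : groupType) (E' : expansion pred_language G') (e : G -> G').
Hypothesis eE : elementary pred_expansion E' e.

(** The nonstandard version of [A]. Its properties below are first-order sentences true in [G] and
    transferred by elementarity. *)
Definition star (A : set G) : set G' :=
  [set x | @rinterp pred_language G' E' A (fun=> x)].

Local Notation var k := (tVar pred_language k).
Local Notation rel A k := (@fRel pred_language A (fun=> var k)).

Lemma star_embed A g : star A (e g) <-> A g.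
Proof. by have := eE (fun=> g) (rel A 0); rewrite /= /star => -[]. Qed.

Lemma star_imp A B C : (forall x, A x -> B x -> C x) ->
  forall x, star A x -> star B x -> star C x.
Proof.
move=> ABC; have [+ _] :=
  eE (fun=> 1) (fAll 0 (fImp (rel A 0) (fImp (rel B 0) (rel C 0)))).
exact.
Qed.

Lemma star_setT x : star setT x.
Proof. by have [+ _] := eE (fun=> 1) (fAll 0 (rel setT 0)); exact. Qed.

Lemma star_set0 x : ~ star set0 x.
Proof.
have [+ _] := eE (fun=> 1) (fAll 0 (fImp (rel set0 0) (fFalse _))).
by move=> /(_ (fun _ => id)) H /H.
Qed.

Lemma star_setC A x : ~ star A x -> star (~` A) x.
Proof.
have [+ _] := eE (fun=> 1)
  (fAll 0 (fImp (fImp (rel A 0) (fFalse _)) (rel (~` A) 0))).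
by move=> /(_ (fun _ => id)) H /H.
Qed.

Lemma star_quot A B C : (forall x y, A x -> B y -> C (x^-1 * y)) ->
  forall x y, star A x -> star B y -> star C (x^-1 * y).
Proof.
move=> ABC x y Ax By.
have [/= + _] := eE (fun=> 1) (fAll 0 (fAll 1 (fAll 2
  (fImp (rel A 0) (fImp (rel B 1)
     (fImp (fEq (tMul (var 0) (var 2)) (var 1)) (rel C 2))))))).
move=> /= H; apply: (H _ x y (x^-1 * y)) => //; last by rewrite mulVKg.
by move=> a b c Aa Bb ab; rewrite -(mulKg a c) ab; exact: ABC.
Qed.

(** * Infinitesimals of a homomorphism to a compact group *)

Variables (K : topGroupType) (f : G -> K).
Hypothesis cK : compact [set: K].
Hypothesis fM : {morph f : x y / x * y}.

Let f1 : f 1 = 1.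
Proof. by apply: (mulgI (f 1)); rewrite -fM !mulg1. Qed.

Let fV : {morph f : x / x^-1}.
Proof. by move=> x; apply: (mulgI (f x)); rewrite -fM !mulgV f1. Qed.

Lemma quot_nbhs (T : topGroupType) (k : T) W : nbhs 1 W -> exists2 N, nbhs k N &
  forall a b, N a -> N b -> W (a^-1 * b).
Proof.
move=> W1.
have [[A B] /= [Ak Bk] AB] : nbhs (k^-1, k) [set xy : T * T | W (xy.1 * xy.2)].
  by apply: mulg_continuous; rewrite /= mulVg.
exists ((fun x => x^-1) @^-1` A `&` B).
  by apply: filterI => //; exact: invg_continuous.
by move=> a b [Aa _] [_ Bb]; exact: (AB (a^-1, b)).
Qed.

(** For Hausdorff [K], the kernel of the standard part map from [G'] to [K]. *)
Definition infinitesimal : set G' :=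
  [set x | forall W, nbhs (1 : K) W -> star (f @^-1` W) x].

Lemma infinitesimal_quot x y :
  infinitesimal x -> infinitesimal y -> infinitesimal (x^-1 * y).
Proof.
move=> Hx Hy W /(quot_nbhs 1)[N N1 NW].
apply: (@star_quot (f @^-1` N) (f @^-1` N)); [|exact: Hx|exact: Hy].
by move=> a b Na Nb; rewrite /preimage /= fM fV; exact: NW.
Qed.

Lemma infinitesimal_subgroup : is_subgroup infinitesimal.
Proof.
have H1 : infinitesimal 1.
  move=> W W1; rewrite -(elementary1 eE); apply/star_embed.
  by rewrite /= f1; exact: nbhs_singleton.
have HV x : infinitesimal x -> infinitesimal x^-1.
  by move=> Hx; rewrite -(mulg1 x^-1); exact: infinitesimal_quot.
split=> // x y /HV Hx Hy.
by rewrite -(invgK x); exact: infinitesimal_quot.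
Qed.

Lemma standard_part x : exists k : K, forall N, nbhs k N -> star (f @^-1` N) x.
Proof.
pose F : set_system K := [set B | star (f @^-1` B) x].
have FF : ProperFilter F.
  split; first exact: star_set0.
  split; first exact: star_setT.
    by move=> A B; apply: star_imp.
  move=> A B AB FA; apply: (star_imp _ FA FA) => y Ay _; exact: AB.
have [k [_ kF]] := cK FF (star_setT x).
exists k => N kN; apply: contrapT => /star_setC nN.
by have [z []] := kF (~` N) N nN kN.
Qed.

Lemma same_type_infinitesimal x y :
  (forall A, star A x -> star A y) -> infinitesimal (x^-1 * y).
Proof.
move=> xy W W1; have [k kx] := standard_part x.
have [N Nk NW] := quot_nbhs k W1.
apply: (@star_quot (f @^-1` N) (f @^-1` N)); [|exact: kx|exact/xy/kx].
by move=> a b Na Nb; rewrite /preimage /= fM fV; exact: NW.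
Qed.

Lemma infinitesimal_bounded :
  bounded_type_definable_subgroup E' (bound pred_language G) (range e) infinitesimal.
Proof.
split; first exact: infinitesimal_subgroup.
  exists [set q | exists2 W, nbhs (1 : K) W & q = (rel (f @^-1` W) 0, fun=> e 1)].
    by move=> _ [W _ ->] k; exists 1.
  apply/seteqP; split=> [x Hx _ [W W1 ->]|x Hx W W1]; first exact: Hx.
  by have := Hx _ (ex_intro2 _ _ W W1 erefl).
(* A coset is coded by the type of a chosen representative, a set of subsets of [G]; it fits in
   [bound] because subsets are relation symbols here. *)
pose h (C : set G') : bound pred_language G :=
  [set z | exists2 A, z = inl (inr A) & star A (xget 1 C)].
have hI : {in left_cosets infinitesimal &, injective h}.
  have cosetP C : left_cosets infinitesimal C ->
      C = [set y | infinitesimal ((xget 1 C)^-1 * y)].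
    have [H1 HM HV] := infinitesimal_subgroup.
    move=> [x _ CE].
    have : C (xget 1 C) by apply: (xgetPex 1); exists x; rewrite -CE /= mulVg.
    move: (xget 1 C) => r; rewrite -{}CE /= => Hr.
    apply/seteqP; split=> y /= Hy.
      by have := infinitesimal_quot Hr Hy; rewrite invgM invgK -mulgA mulVKg.
    by have := HM _ _ Hr Hy; rewrite -mulgA mulVKg.
  move=> C D /set_mem/cosetP CE /set_mem/cosetP DE hCD.
  have CD A : star A (xget 1 C) -> star A (xget 1 D).
    move=> AC; have : h C (inl (inr A)) by exists A.
    by rewrite hCD => -[B [<-]].
  have [H1 HM HV] := infinitesimal_subgroup.
  have Hcd := same_type_infinitesimal CD.
  rewrite CE DE; apply/seteqP; split=> y /= Hy.
    by have := infinitesimal_quot Hcd Hy; rewrite invgM invgK -mulgA mulVKg.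
  by have := HM _ _ Hcd Hy; rewrite -mulgA mulVKg.
rewrite -(card_le_eql (inj_card_eq hI)).
exact/subset_card_le/subsetT.
Qed.

End PredicateExpansion.

(** Connectedness makes every [e g] infinitesimal, so [f g] lies in every neighbourhood of 1, and
    [K] is Hausdorff. *)
Lemma type_absolutely_connected_hom (G : groupType) (K : topGroupType) (f : G -> K) :
  type_absolutely_connected G -> compact_hausdorff K ->
  {morph f : x y / x * y} -> forall g, f g = 1.
Proof.
move=> Gtc [cK hK] fM g.
pose enc (n : nat) : bound (pred_language G) G := [set inr n].
have encI : injective enc.
  by move=> m n mn; have : enc m (inr m) by []; rewrite mn => -[].
have [G' [E' [e [eE E's]]]] := saturated_extension (pred_expansion G) encI.
have [_ /(_ _ (infinitesimal_bounded eE cK fM)) H] := Gtc _ _ _ _ _ eE E's.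
apply: hK => A B fgA B1; exists (f g); split; first exact: nbhs_singleton.
by have /(star_embed eE) := H (e g) I B B1.
Qed.

(** * Definable sets *)

Section Renaming.
Variables (L : language) (G : groupType) (E : expansion L G).

Fixpoint trename (f : nat -> nat) (t : term L) : term L :=
  match t with
  | tVar n => tVar L (f n)
  | tMul t1 t2 => tMul (trename f t1) (trename f t2)
  | tFun g ts => @tFun L g (fun i => trename f (ts i))
  end.

(** Bound variables are renamed too, so injectivity of [f] alone excludes capture. *)
Fixpoint frename (f : nat -> nat) (phi : formula L) : formula L :=
  match phi with
  | fEq t1 t2 => fEq (trename f t1) (trename f t2)
  | fRel r ts => @fRel L r (fun i => trename f (ts i))
  | fFalse => fFalse L
  | fImp phi1 phi2 => fImp (frename f phi1) (frename f phi2)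
  | fAll n phi1 => fAll (f n) (frename f phi1)
  end.

Lemma eval_rename f (v : nat -> G) t : eval E v (trename f t) = eval E (v \o f) t.
Proof.
elim: t => [n|t IH t' IH'|g ts IH] //=; first by rewrite IH IH'.
by congr finterp; apply/funext => i; exact: IH.
Qed.

Lemma sat_rename f (v : nat -> G) phi : injective f ->
  sat E v (frename f phi) <-> sat E (v \o f) phi.
Proof.
move=> fI; elim: phi v => [t t'|r ts| |phi IH phi' IH'|n phi IH] v //=.
- by rewrite !eval_rename.
- rewrite (_ : (fun i => eval E v _) = fun i => eval E (v \o f) (ts i))//.
  by apply/funext => i; rewrite eval_rename.
- by split=> H /IH/H/IH'.
- have updE x : (fun k => if k == f n then x else v k) \o f =
                (fun k => if k == n then x else (v \o f) k).
    by apply/funext => k /=; rewrite (inj_eq fI).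
  by split=> H x; have := H x; rewrite IH updE.
Qed.

End Renaming.

Definition mix (T : Type) (v a : nat -> T) (k : nat) : T :=
  if odd k then a k./2 else v k./2.

Definition mix_ren (f g : nat -> nat) (k : nat) : nat :=
  if odd k then (g k./2).*2.+1 else (f k./2).*2.

Lemma mix_ren_inj f g : injective f -> injective g -> injective (mix_ren f g).
Proof.
move=> fI gI k l; rewrite /mix_ren => kl.
have oE : odd k = odd l.
  by have := congr1 odd kl; case: (odd k); case: (odd l); rewrite /= ?odd_double.
rewrite -(odd_double_half k) -(odd_double_half l) oE; congr (_ + _.*2)%N.
move: kl; rewrite oE; case: (odd l) => [[]|] /double_inj; first exact: gI.
exact: fI.
Qed.

Lemma mix_renE (T : Type) (v a : nat -> T) f g :
  mix v a \o mix_ren f g = mix (v \o f) (a \o g).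
Proof.
apply/funext => k; rewrite /= /mix_ren /mix; case: (odd k) => /=.
  by rewrite odd_double /= uphalf_double.
by rewrite odd_double doubleK.
Qed.

Lemma mix_even (T : Type) (v a : nat -> T) k : mix v a k.*2 = v k.
Proof. by rewrite /mix odd_double doubleK. Qed.

Lemma mix_odd (T : Type) (v a : nat -> T) k : mix v a k.*2.+1 = a k.
Proof. by rewrite /mix /= odd_double /= uphalf_double. Qed.

Section Definable.
Variables (L : language) (G : groupType) (E : expansion L G).

(* The variables of the relation sit at the even positions and the parameters
   at the odd ones, which leaves infinitely many variables free for binding. *)
Definition definable (A : set G) (X : set (nat -> G)) : Prop :=
  exists (phi : formula L) (a : nat -> G),
    (forall k, A (a k)) /\ forall v, X v <-> sat E (mix v a) phi.

Definition definable_set (A D : set G) : Prop := definable A [set v | D (v 0)].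

Lemma definable_sub A B X : A `<=` B -> definable A X -> definable B X.
Proof. by move=> AB [phi [a [Aa Xa]]]; exists phi, a; split=> // k; exact: AB. Qed.

Lemma definable_ext A X Y : (forall v, X v <-> Y v) -> definable A X -> definable A Y.
Proof.
move=> XY [phi [a [Aa Xa]]]; exists phi, a; split=> // v.
by rewrite -XY Xa.
Qed.

(** The two parameter sequences are interleaved as [mix a b], and each formula is renamed to read
    its own half. *)
Lemma definable_imp A X Y : definable A X -> definable A Y ->
  definable A [set v | X v -> Y v].
Proof.
move=> [phi [a [Aa Xa]]] [psi [b [Ab Yb]]].
exists (fImp (frename (mix_ren id double) phi)
             (frename (mix_ren id (succn \o double)) psi)), (mix a b).
split; first by move=> k; rewrite /mix; case: odd.
have dI := double_inj; have sdI := inj_comp succn_inj double_inj.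
have idI := @inj_id nat.
move=> v /=; rewrite !sat_rename ?mix_renE; try exact: mix_ren_inj.
rewrite (_ : mix a b \o double = a); last by apply/funext => k; exact: mix_even.
rewrite (_ : mix a b \o (succn \o double) = b); last by apply/funext => k; exact: mix_odd.
by rewrite Xa Yb.
Qed.

Lemma definable_all A X (n : nat) : definable A X ->
  definable A [set v | forall x, X (fun k => if k == n then x else v k)].
Proof.
move=> [phi [a [Aa Xa]]]; exists (fAll n.*2 phi), a; split=> // v /=.
suff updE x : (fun k => if k == n.*2 then x else mix v a k) =
    mix (fun k => if k == n then x else v k) a.
  by split=> H x; have := H x; rewrite updE Xa.
apply/funext => k; rewrite /mix; case: eqP => [->|kn].
  by rewrite odd_double doubleK eqxx.
case: ifPn => // ok; case: eqP => // kn'; case: kn.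
by rewrite -kn' even_halfK.
Qed.

Lemma definable_rename A X (f : nat -> nat) : injective f -> definable A X ->
  definable A [set v : nat -> G | X (v \o f)].
Proof.
move=> fI [phi [a [Aa Xa]]]; exists (frename (mix_ren f id) phi), a; split=> // v.
by rewrite sat_rename ?mix_renE; [exact: Xa|exact: mix_ren_inj].
Qed.

Lemma definable_var A D n : definable_set A D -> definable A [set v | D (v n)].
Proof.
move=> /(definable_rename (@addIn n)); apply: definable_ext => v.
by rewrite /= add0n.
Qed.

Lemma definable_psat A (q : pformula L G) : (forall k, A (q.2 k)) ->
  definable_set A (psat E q).
Proof.
move=> Aq; pose r k := if k is j.+1 then j.*2.+1 else 0%N.
exists (frename r q.1), q.2; split=> // v; rewrite sat_rename; last first.
  by move=> [|i] [|j] //= [] /double_inj->.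
rewrite /psat /= (_ : mix v q.2 \o r = fun k => if k is k'.+1 then q.2 k' else v 0%N)//.
by apply/funext => -[//|k] /=; rewrite mix_odd.
Qed.

Lemma psat_definable A D : definable_set A D ->
  exists q : pformula L G, (forall k, A (q.2 k)) /\ D = psat E q.
Proof.
move=> [phi [a [Aa Da]]].
(* The even positions other than 0 are filled with [a 0], so that all parameters lie in [A]. *)
exists (phi, fun k => mix (fun=> a 0%N) a k.+1); split.
  by move=> k /=; rewrite /mix; case: ifP.
apply/seteqP; suff H x : D x <-> psat E (phi, fun k => mix (fun=> a 0%N) a k.+1) x.
  by split=> x /H.
have := Da (scons x (fun=> a 0%N)); rewrite /psat /=.
rewrite (_ : mix (scons x _) a =
  fun k => if k is k'.+1 then mix (fun=> a 0%N) a k'.+1 else x)//.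
apply/funext => -[//|k]; rewrite /mix; case: ifPn => //= ok.
by case: k ok.
Qed.

Variable A : set G.
Hypothesis A0 : A !=set0.

Lemma definable_false : definable A [set v | False].
Proof. by have [a Aa] := A0; exists (fFalse L), (fun=> a). Qed.

Lemma definable_not X : definable A X -> definable A [set v | ~ X v].
Proof. by move=> /definable_imp/(_ definable_false). Qed.

Lemma definable_and X Y : definable A X -> definable A Y ->
  definable A [set v | X v /\ Y v].
Proof.
move=> dX /definable_not dY; apply: definable_ext (definable_not (definable_imp dX dY)).
move=> v /=; split=> [H|[Xv Yv] /(_ Xv)/(_ Yv)//].
by split; apply: contrapT => nX; apply: H => // /nX.
Qed.

Lemma definable_par n b : A b -> definable A [set v | v n = b].
Proof.
move=> Ab; exists (fEq (tVar L n.*2) (tVar L 1)), (fun=> b); split=> // v.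
by rewrite /= mix_even.
Qed.

Lemma definable_mul i j k : definable A [set v | v i * v j = v k].
Proof.
have [a Aa] := A0.
exists (fEq (tMul (tVar L i.*2) (tVar L j.*2)) (tVar L k.*2)), (fun=> a).
by split=> // v; rewrite /= !mix_even.
Qed.

Lemma definable_mul2 i j k l : definable A [set v | v i * v j = v k * v l].
Proof.
have [a Aa] := A0.
exists (fEq (tMul (tVar L i.*2) (tVar L j.*2)) (tMul (tVar L k.*2) (tVar L l.*2))), (fun=> a).
by split=> // v; rewrite /= !mix_even.
Qed.

Lemma definable_setT : definable_set A setT.
Proof. by apply: definable_ext (definable_not definable_false) => v; split=> // _ []. Qed.

Lemma definable_setI D D' : definable_set A D -> definable_set A D' ->
  definable_set A (D `&` D').
Proof. exact: definable_and. Qed.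

Lemma definable_setC D : definable_set A D -> definable_set A (~` D).
Proof. exact: definable_not. Qed.

(** Terms have no inverse, so [b^-1 * x] is described as the [z] with [b * z = x]. *)
Lemma definable_translate D b : A b -> definable_set A D ->
  definable_set A [set x | D (b^-1 * x)].
Proof.
move=> Ab dD.
apply: definable_ext (definable_all 1 (definable_all 2 (definable_imp
  (definable_par 1 Ab) (definable_imp (definable_mul 1 2 0) (definable_var 2 dD))))).
move=> v /=; split=> [/(_ b (b^-1 * v 0%N)) H|H _ z -> bz].
  by apply: H => //; rewrite mulVKg.
by rewrite -(mulKg b z) bz.
Qed.

Lemma definable_core D : definable_set A D ->
  definable_set A [set x | forall g, D (x ^ g)].
Proof.
move=> dD.
apply: definable_ext (definable_all 1 (definable_all 2 (definable_imp
  (definable_mul2 1 2 0 1) (definable_var 2 dD)))).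
move=> v /=; split=> [H g|H g z gz].
  by apply: (H g); rewrite conjgE mulVKg.
by rewrite -(mulKg g z) gz; exact: H.
Qed.

Lemma definable_quot D D' : definable_set A D -> definable_set A D' ->
  definable_set A [set x | D' x /\ exists2 y, D' y & ~ D (x^-1 * y)].
Proof.
move=> dD dD'; apply: definable_and => //.
apply: definable_ext (definable_not (definable_all 1 (definable_imp (definable_var 1 dD')
  (definable_all 2 (definable_imp (definable_mul 0 2 1) (definable_var 2 dD)))))).
move=> v /=; split=> [H|[y D'y nD] H]; last first.
  by apply/nD/(H y) => //; rewrite mulVKg.
apply: contrapT => nex; apply: H => y D'y z yz; apply: contrapT => nDz.
by apply: nex; exists y => //; rewrite -yz mulKg.
Qed.

End Definable.

(** Saturation for directed families: finitely many members contain a common nonempty one, so the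
    formulas defining members form a finitely satisfiable type. *)
Lemma saturated_directed (L : language) (G : groupType) (E : expansion L G)
    (J : Type) (A : set G) (F : set (set G)) :
  saturated E J -> A #<= [set: J] ->
  (forall X, F X -> definable_set E A X) -> (forall X, F X -> X !=set0) ->
  (forall X Y, F X -> F Y -> exists2 Z, F Z & Z `<=` X `&` Y) ->
  exists x, forall X, F X -> X x.
Proof.
move=> Esat AJ Fdef Fne Fdir.
have [[X0 FX0]|F0] := pselect (exists X, F X); last first.
  by exists 1 => X FX; case: F0; exists X.
pose p : set (pformula L G) := [set q | (forall k, A (q.2 k)) /\ F (psat E q)].
have [| |x xp] := Esat A AJ p; first by move=> q [].
- move=> q fq qp; suff [Z FZ Zq] : exists2 Z, F Z & Z `<=` realizations E q.
    by have [z /Zq] := Fne Z FZ; exists z.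
  elim/finite_set_ind: q / fq qp => [|c q IH] cqp; first by exists X0 => // x _ c [].
  have [|Z FZ Zq] := IH; first by move=> d qd; apply: cqp; right.
  have [|_ Fc] := cqp c; first by left.
  have [Y FY YZ] := Fdir _ _ FZ Fc.
  by exists Y => // x /YZ[/Zq xq xc] d [->|/xq].
- exists x => X FX; have [q [Aq XE]] := psat_definable (Fdef X FX).
  by rewrite XE; apply: xp; split=> //; rewrite -XE.
Qed.

(** * Quotient by the infinitesimals of a totally bounded group topology *)

Section QuotientTopologicalGroup.
Variable G : groupType.

(** A neighbourhood basis at 1, invariant under conjugation, of a group topology that may fail to be
    Hausdorff. *)
Record group_basis : Type := GroupBasis {
  gb : set (set G);
  gb_nonempty : gb !=set0;
  gb_directed : forall P Q, gb P -> gb Q -> exists2 R, gb R & R `<=` P `&` Q;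
  gb1 : forall Q, gb Q -> Q 1;
  gb_quot : forall Q, gb Q ->
    exists2 R, gb R & forall x y, R x -> R y -> Q (x^-1 * y);
  gb_conj : forall Q, gb Q -> forall x g, Q x -> Q (x ^ g)
}.

Variable B : group_basis.

Lemma gb_sym Q : gb B Q -> exists2 R, gb B R & forall x, R x -> Q x /\ Q x^-1.
Proof.
move=> /gb_quot[R BR RQ]; exists R => // x Rx; split.
  by rewrite -(mul1g x) -invg1; apply: RQ => //; exact: gb1 BR.
by rewrite -(mulg1 x^-1); apply: RQ => //; exact: gb1 BR.
Qed.

Lemma gb_mul Q : gb B Q -> exists2 R, gb B R & forall x y, R x -> R y -> Q (x * y).
Proof.
move=> /gb_quot[P BP PQ]; have [R BR RP] := gb_sym BP; exists R => // x y Rx Ry.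
by rewrite -(invgK x); apply: PQ; [case: (RP x Rx)|case: (RP y Ry)].
Qed.

(** Congruence modulo the intersection of the basis, a normal subgroup; dividing by it makes the
    topology Hausdorff. *)
Definition gb_eq (x y : G) : bool := `[< forall Q, gb B Q -> Q (x^-1 * y) >].

Lemma gb_eq_refl : reflexive gb_eq.
Proof. by move=> x; apply/asboolP => Q BQ; rewrite mulVg; exact: gb1 BQ. Qed.

Lemma gb_eq_sym : symmetric gb_eq.
Proof.
suff H x y : gb_eq x y -> gb_eq y x by move=> x y; apply/idP/idP; exact: H.
move=> /asboolP xy; apply/asboolP => Q /gb_sym[R BR RQ].
by have [_] := RQ _ (xy R BR); rewrite invgM invgK.
Qed.

Lemma gb_eq_trans : transitive gb_eq.
Proof.
move=> y x z /asboolP xy /asboolP yz; apply/asboolP => Q /gb_mul[R BR RQ].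
by rewrite -(mulgK y (x^-1)) -mulgA; apply: RQ; [exact: xy|exact: yz].
Qed.

Definition gb_equiv : equiv_rel G :=
  EquivRel gb_eq gb_eq_refl gb_eq_sym gb_eq_trans.

Definition gb_quotient : Type := {eq_quot gb_equiv}%qT.
HB.instance Definition _ := Choice.copy gb_quotient {eq_quot gb_equiv}%qT.

Definition gb_class (x : G) : gb_quotient := \pi_({eq_quot gb_equiv})%qT x.
Definition gb_repr (k : gb_quotient) : G := repr (k : {eq_quot gb_equiv}%qT).

Lemma gb_reprK k : gb_class (gb_repr k) = k.
Proof. exact: reprK. Qed.

Lemma gb_classP x y : gb_class x = gb_class y <-> forall Q, gb B Q -> Q (x^-1 * y).
Proof.
split=> [/eqP|H]; first by rewrite eqmodE => /asboolP.
by apply/eqP; rewrite eqmodE; apply/asboolP.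
Qed.

Lemma gb_class_repr x Q : gb B Q -> Q ((gb_repr (gb_class x))^-1 * x).
Proof. by move: Q; apply/gb_classP; rewrite gb_reprK. Qed.

Definition gb_mulq (k l : gb_quotient) : gb_quotient :=
  gb_class (gb_repr k * gb_repr l).
Definition gb_invq (k : gb_quotient) : gb_quotient := gb_class (gb_repr k)^-1.

Lemma gb_mulqE x y : gb_mulq (gb_class x) (gb_class y) = gb_class (x * y).
Proof.
apply/gb_classP => Q BQ; have [R BR RQ] := gb_mul BQ.
set r := gb_repr _; set s := gb_repr _.
rewrite (_ : (r * s)^-1 * (x * y) = (r^-1 * x) ^ s * (s^-1 * y)).
  by apply: RQ; [apply: (gb_conj BR)|]; exact: gb_class_repr.
by rewrite conjgE invgM !mulgA mulgK.
Qed.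

Lemma gb_invqE x : gb_invq (gb_class x) = gb_class x^-1.
Proof.
apply/gb_classP => Q BQ; have [R BR RQ] := gb_sym BQ.
set r := gb_repr _.
rewrite (_ : r^-1^-1 * x^-1 = ((r^-1 * x)^-1) ^ r^-1).
  apply: (gb_conj BQ); have [] // := RQ (r^-1 * x); exact: gb_class_repr.
by rewrite conjgE invgM !invgK -!mulgA mulgV mulg1.
Qed.

Lemma gb_mulqA : associative gb_mulq.
Proof.
move=> k l m; rewrite -(gb_reprK k) -(gb_reprK l) -(gb_reprK m).
by rewrite !gb_mulqE mulgA.
Qed.

Lemma gb_mul1q : left_id (gb_class 1) gb_mulq.
Proof. by move=> k; rewrite -(gb_reprK k) gb_mulqE mul1g. Qed.

Lemma gb_mulq1 : right_id (gb_class 1) gb_mulq.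
Proof. by move=> k; rewrite -(gb_reprK k) gb_mulqE mulg1. Qed.

Lemma gb_mulVq : left_inverse (gb_class 1) gb_invq gb_mulq.
Proof. by move=> k; rewrite -(gb_reprK k) gb_invqE gb_mulqE mulVg. Qed.

Lemma gb_mulqV : right_inverse (gb_class 1) gb_invq gb_mulq.
Proof. by move=> k; rewrite -(gb_reprK k) gb_invqE gb_mulqE mulgV. Qed.

HB.instance Definition _ := isGroup.Build gb_quotient
  gb_mulqA gb_mul1q gb_mulq1 gb_mulVq gb_mulqV.

Lemma gb_classM : {morph gb_class : x y / x * y}.
Proof. by move=> x y; exact/esym/gb_mulqE. Qed.

Definition gb_nbhs (k : gb_quotient) : set_system gb_quotient :=
  [set A | exists2 Q, gb B Q & forall x, Q ((gb_repr k)^-1 * x) -> A (gb_class x)].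

HB.instance Definition _ := hasNbhs.Build gb_quotient gb_nbhs.

Lemma gb_nbhsP x (A : set gb_quotient) : nbhs (gb_class x) A <->
  exists2 Q, gb B Q & forall y, Q (x^-1 * y) -> A (gb_class y).
Proof.
have xr Q : gb B Q -> Q ((gb_repr (gb_class x))^-1 * x) by exact: gb_class_repr.
split=> -[Q BQ QA]; have [R BR RQ] := gb_mul BQ.
  exists R => // y Ry; apply: QA.
  by rewrite -(mulgK x (gb_repr _)^-1) -mulgA; apply: RQ => //; exact: xr.
have [S BS SR] := gb_sym BR.
exists R => // y Ry; apply: QA.
rewrite -(mulgK (gb_repr (gb_class x)) x^-1) -mulgA; apply: RQ => //.
by have [_] := SR _ (xr S BS); rewrite invgM invgK.
Qed.

Lemma gb_nbhs_filter (k : gb_quotient) : ProperFilter (nbhs k).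
Proof.
rewrite -(gb_reprK k); move: (gb_repr k) => x; split.
  move=> /gb_nbhsP[Q BQ /(_ x)]; apply; rewrite mulVg; exact: gb1 BQ.
split.
- by have [Q BQ] := gb_nonempty B; apply/gb_nbhsP; exists Q.
- move=> A A' /gb_nbhsP[Q BQ QA] /gb_nbhsP[Q' BQ' QA']; apply/gb_nbhsP.
  have [R BR RQ] := gb_directed BQ BQ'.
  by exists R => // y /RQ[/QA Ay /QA' A'y].
- move=> A A' AA' /gb_nbhsP[Q BQ QA]; apply/gb_nbhsP.
  by exists Q => // y /QA/AA'.
Qed.

Lemma gb_nbhs_singleton (k : gb_quotient) (A : set gb_quotient) : nbhs k A -> A k.
Proof.
rewrite -(gb_reprK k) => /gb_nbhsP[Q BQ]; apply; rewrite mulVg; exact: gb1 BQ.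
Qed.

Lemma gb_nbhs_nbhs (k : gb_quotient) (A : set gb_quotient) :
  nbhs k A -> nbhs k (nbhs^~ A).
Proof.
rewrite -(gb_reprK k); move: (gb_repr k) => x /gb_nbhsP[Q BQ QA]; apply/gb_nbhsP.
have [R BR RQ] := gb_mul BQ; exists R => // y Ry; apply/gb_nbhsP.
exists R => // z Rz; apply: QA.
by rewrite -(mulgK y x^-1) -mulgA; exact: RQ.
Qed.

HB.instance Definition _ := Nbhs_isNbhsTopological.Build gb_quotient
  gb_nbhs_filter gb_nbhs_singleton gb_nbhs_nbhs.

Lemma gb_mulg_continuous :
  continuous (fun kl : gb_quotient * gb_quotient => kl.1 * kl.2).
Proof.
move=> [k l]; rewrite -(gb_reprK k) -(gb_reprK l).
move: (gb_repr k) (gb_repr l) => {k l} x y A /=.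
rewrite -gb_classM => /gb_nbhsP[Q BQ QA].
have [R BR RQ] := gb_mul BQ.
exists (gb_class @` [set x' | R (x^-1 * x')], gb_class @` [set y' | R (y^-1 * y')]).
  split=> /=; apply/gb_nbhsP; exists R => // z Rz; by exists z.
move=> [_ _] [/= [x' Rx' <-] [y' Ry' <-]] /=; rewrite -gb_classM; apply: QA.
rewrite (_ : (x * y)^-1 * (x' * y') = (x^-1 * x') ^ y * (y^-1 * y')).
  by apply: RQ => //; exact: (gb_conj BR).
by rewrite conjgE invgM !mulgA mulgK.
Qed.

Lemma gb_invg_continuous : continuous (fun k : gb_quotient => k^-1).
Proof.
move=> k; rewrite -(gb_reprK k); move: (gb_repr k) => {k} x A /=.
rewrite -[(gb_class x)^-1]/(gb_invq _) gb_invqE => /gb_nbhsP[Q BQ QA].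
have [R BR RQ] := gb_sym BQ.
apply/gb_nbhsP; exists R => // y Ry.
rewrite /= -[(gb_class y)^-1]/(gb_invq _) gb_invqE; apply: QA.
rewrite (_ : x^-1^-1 * y^-1 = ((x^-1 * y)^-1) ^ x^-1).
  by apply: (gb_conj BQ); have [] := RQ _ Ry.
by rewrite conjgE invgM !invgK -!mulgA mulgV mulg1.
Qed.

HB.instance Definition _ := isTopologicalGroup.Build gb_quotient
  gb_mulg_continuous gb_invg_continuous.

Lemma gb_hausdorff : hausdorff_space gb_quotient.
Proof.
move=> k l; rewrite -(gb_reprK k) -(gb_reprK l).
move: (gb_repr k) (gb_repr l) => {k l} x y xy; apply/gb_classP => Q BQ.
have [R BR RQ] := gb_mul BQ; have [S BS SR] := gb_mul BR.
have [T BT TS] := gb_sym BS; have [T' BT' TT'] := gb_directed BT BR.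
have [||_ [[z Tz <-] [w Tw zw]]] := xy
  (gb_class @` [set z | T' (x^-1 * z)]) (gb_class @` [set w | T' (y^-1 * w)]).
- by apply/gb_nbhsP; exists T' => // z Tz; exists z.
- by apply/gb_nbhsP; exists T' => // z Tz; exists z.
(* The elements [z] and [w] represent one common point of the two neighbourhoods, so all three
   factors are small. *)
rewrite (_ : x^-1 * y = (x^-1 * z) * ((w^-1 * z)^-1 * (y^-1 * w)^-1)); last first.
  by rewrite !invgM !invgK -!mulgA mulVKg mulVKg.
have [T'z T'w] := (TT' _ Tz, TT' _ Tw).
apply: RQ; first by case: T'z.
apply: SR; last by have [/TS[]] := T'w.
by have /gb_classP/(_ T BT)/TS[] := zw.
Qed.

End QuotientTopologicalGroup.

(** * Bounded type-definable subgroups *)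

Lemma injective_card_leT (T U : Type) (f : T -> U) :
  injective f -> [set: T] #<= [set: U].
Proof.
move=> fI; rewrite -(card_le_eql (inj_card_eq (A := [set: T]) (f := f) _)).
  exact/subset_card_le/subsetT.
by move=> x y _ _; exact: fI.
Qed.

Lemma bound_absorbs (L : language) (G : Type) (T : Type)
    (e : G -> T) (r : bound L G -> T) :
  range e `|` range r #<= [set: bound L G].
Proof.
pose s (z : G + bound L G) := match z with inl g => e g | inr j => r j end.
have -> : range e `|` range r = range s.
  apply/seteqP; split=> x.
    by move=> [[g _ <-]|[j _ <-]]; [exists (inl g)|exists (inr j)].
  by move=> [[g|j] _ <-]; [left; exists g|right; exists j].
apply: card_le_trans (card_image_le _ _) _.
(* Membership of [inr 0] tells the two summands apart; sets from the second are shifted on [nat] to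
   free that point. *)
pose enc (z : G + bound L G) : bound L G :=
  match z with
  | inl g => [set w | w = inr 0%N \/ w = inl (inl (inl g))]
  | inr j => [set w | match w with
                      | inl w' => j (inl w')
                      | inr 0 => False
                      | inr n.+1 => j (inr n)
                      end]
  end.
apply: (@injective_card_leT _ _ enc) => -[g|j] [g'|j'] eq_enc.
- have : enc (inl g) (inl (inl (inl g))) by right.
  by rewrite eq_enc => -[//|[->]].
- have : enc (inl g) (inr 0%N) by left.
  by rewrite eq_enc.
- have : enc (inl g') (inr 0%N) by left.
  by rewrite -eq_enc.
- congr inr; apply/funext => -[w|n].
    exact: (congr1 (fun X => X (inl w)) eq_enc).
  exact: (congr1 (fun X => X (inr n.+1)) eq_enc).
Qed.

(** * Finite colourings *)

Section FiniteColouring.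
Variable G : groupType.

(* The combinatorial content of "thick": pulling a colouring back along
   translations and inversion shows stability under conjugation, and pairing
   colourings gives stability under finite intersections. *)
Definition finitely_coloured (P : set G) : Prop :=
  exists (T : finType) (c : G -> T), forall x y, c x = c y -> P (x^-1 * y).

Lemma finitely_coloured_sub P Q : P `<=` Q ->
  finitely_coloured P -> finitely_coloured Q.
Proof. by move=> PQ [T [c cP]]; exists T, c => x y /cP/PQ. Qed.

Lemma finitely_colouredV P : finitely_coloured P ->
  finitely_coloured [set x | P x^-1].
Proof.
move=> [T [c cP]]; exists T, c => x y cxy /=; rewrite invgM invgK.
exact: cP.
Qed.

Lemma finitely_colouredJ P g : finitely_coloured P ->
  finitely_coloured [set x | P (x ^ g)].
Proof.
move=> [T [c cP]]; exists T, (fun x => c (x * g)) => x y /cP.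
by rewrite /= conjgE invgM !mulgA.
Qed.

Lemma finitely_coloured_seq (I : eqType) (s : seq I) (P : I -> set G) :
  (forall i, i \in s -> finitely_coloured (P i)) ->
  finitely_coloured [set x | forall i, i \in s -> P i x].
Proof.
elim: s => [|i s IH] sP; first by exists unit, (fun=> tt).
have [|T [c cP]] := sP i; first exact: mem_head.
have [j js|T' [c' cP']] := IH; first by apply: sP; rewrite in_cons js orbT.
exists (T * T')%type, (fun x => (c x, c' x)) => x y [cxy cxy'] j.
rewrite in_cons => /orP[/eqP->|]; first exact: cP.
exact: cP'.
Qed.

End FiniteColouring.

Lemma ultra_seq (T : Type) (I : choiceType) (F : set_system T) (s : seq I)
    (f : I -> set T) : UltraFilter F ->
  (forall x, exists2 i, i \in s & f i x) -> exists2 i, i \in s & F (f i).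
Proof.
move=> UF sf; apply: contrapT => nF.
have H i : [set` s] i -> F (~` f i).
  by move=> si; apply: ultra_complement => Fi; apply: nF; exists i.
have [x xs] := filter_ex (filter_finite_bigI _ (finite_seq s) H).
by have [i si] := sf x; exact: xs.
Qed.

(** * Definable sets around a bounded subgroup and the compact quotient *)

Section Component.
Variables (L : language) (G G' : groupType).
Variables (E : expansion L G) (E' : expansion L G') (e : G -> G').
Hypothesis eE : elementary E E' e.
Hypothesis E's : saturated E' (bound L G).
Variable H : set G'.
Hypothesis Hb : bounded_type_definable_subgroup E' (bound L G) (range e) H.

Local Notation Gdef := (definable_set E' (range e)).

Let G0 : range e !=set0.
Proof. by exists (e 1); exists 1. Qed.

Let H1 : H 1. Proof. by case: Hb => -[]. Qed.
Let HM x y : H x -> H y -> H (x * y). Proof. by case: Hb => -[_ + _] _ _; exact. Qed.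
Let HV x : H x -> H x^-1. Proof. by case: Hb => -[_ _ +] _ _; exact. Qed.

(** That [D] is everything is a first-order statement with parameters from [G], so it may be checked
    in [G]. *)
Lemma definable_dense D : Gdef D -> (forall g, D (e g)) -> D = setT.
Proof.
move=> /psat_definable[q [qe ->]] De; apply/seteqP; split=> // x _.
have /choice[a ae] : forall k, exists g, e g = q.2 k.
  by move=> k; have [g _ <-] := qe k; exists g.
have [+ _] := eE (scons 1 a) (fAll 0 q.1).
have updE y : (fun k => if k == 0%N then y else (e \o scons 1 a) k) =
    (fun k => if k is k'.+1 then q.2 k' else y).
  by apply/funext => -[//|k] /=; rewrite ae.
move=> /= /(_ _)/(_ x); rewrite updE; apply=> g.
apply/eE; have := De g; rewrite /psat -updE.
by congr (sat E' _ _); apply/funext => -[|k].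
Qed.

Definition envelope : set (set G') := [set D | Gdef D /\ H `<=` D].

Lemma envelopeI D D' : envelope D -> envelope D' -> envelope (D `&` D').
Proof.
move=> [dD HD] [dD' HD']; split; first exact: definable_setI.
by move=> x Hx; split; [exact: HD|exact: HD'].
Qed.

Lemma envelope_bigcap x : (forall D, envelope D -> D x) -> H x.
Proof.
move=> xD; have [_ [p pe HE] _] := Hb; rewrite HE => q pq.
apply: (xD (psat E' q)); split; first by apply: definable_psat; exact: pe.
by rewrite HE => y; exact.
Qed.

Lemma card_embed_range : range e #<= [set: bound L G].
Proof.
by apply: card_le_trans (bound_absorbs (L := L) e (fun=> 1)); exact/subset_card_le/subsetUl.
Qed.

(** Otherwise saturation is used twice: it gives [x] in [H] such that each [D'] contains some [y]
    with [x^-1 * y] outside [D], then, with [x] as a new parameter, one such [y] in [H]. This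
    contradicts that [H] is a subgroup inside [D]. *)
Lemma envelope_quot D : envelope D ->
  exists2 D', envelope D' & forall x y, D' x -> D' y -> D (x^-1 * y).
Proof.
move=> [dD HD]; apply: contrapT => nex.
have bad D' : envelope D' -> exists x y, [/\ D' x, D' y & ~ D (x^-1 * y)].
  move=> eD'; apply: contrapT => nbad; apply: nex; exists D' => // x y D'x D'y.
  by apply: contrapT => nD; apply: nbad; exists x, y.
have [|||x xP] := saturated_directed (F := [set X | exists2 D', envelope D' &
    X = [set x | D' x /\ exists2 y, D' y & ~ D (x^-1 * y)]]) E's card_embed_range.
- by move=> _ [D' [dD' _] ->]; exact: definable_quot.
- move=> _ [D' eD' ->]; have [x [y [D'x D'y nD]]] := bad D' eD'.
  by exists x; split=> //; exists y.
- move=> _ _ [D1 eD1 ->] [D2 eD2 ->]; eexists; first by exists (D1 `&` D2); [exact: envelopeI|].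
  by move=> x [[D1x D2x] [y [D1y D2y] nD]]; split; split=> //; exists y.
have {}xP D' : envelope D' -> D' x /\ exists2 y, D' y & ~ D (x^-1 * y).
  by move=> eD'; apply: (xP [set x | _]); exists D'.
have Hx : H x by apply: envelope_bigcap => D' /xP[].
pose A := range e `|` range (fun _ : bound L G => x).
have A0 : A !=set0 by exists x; right; exists set0.
have Ax : A x by right; exists set0.
have eA : range e `<=` A by move=> y; left.
have [|||y yP] := saturated_directed (A := A) (F := [set X | exists2 D', envelope D' &
    X = D' `&` ~` [set y | D (x^-1 * y)]]) E's (bound_absorbs _ _).
- move=> _ [D' [dD' _] ->]; apply: definable_setI => //; first exact: definable_sub dD'.
  apply: definable_setC => //; apply: definable_translate => //.
  exact: definable_sub dD.
- by move=> _ [D' /xP[_ [y D'y nD]] ->]; exists y.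
- move=> _ _ [D1 eD1 ->] [D2 eD2 ->]; eexists; first by exists (D1 `&` D2); [exact: envelopeI|].
  by move=> y [[D1y D2y] nD].
have {}yP D' : envelope D' -> D' y /\ ~ D (x^-1 * y).
  by move=> eD'; apply: (yP (D' `&` ~` [set y | D (x^-1 * y)])); exists D'.
have Hy : H y by apply: envelope_bigcap => D' /yP[].
by have [_] := yP D (conj dD HD); apply; apply/HD/HM => //; exact: HV.
Qed.

Lemma coset_representatives : exists r : bound L G -> G', forall x, exists j,
  H ((r j)^-1 * x).
Proof.
have [_ _ cardH] := Hb.
have [|s sE] := card_le_range _ cardH; first by exists [set y | H (1^-1 * y)]; exists 1.
have /choice[r rs] : forall j, exists x, s j = [set y | H (x^-1 * y)].
  move=> j; have : left_cosets H (s j) by rewrite sE; exists j.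
  by move=> [x _ <-]; exists x.
exists r => x.
have : left_cosets H [set y | H (x^-1 * y)] by exists x.
rewrite sE => -[j _ sj]; exists j.
have : [set y | H (x^-1 * y)] x by rewrite /= mulVg.
by rewrite -sj rs.
Qed.

(* If no finite union of translates of D were everything, saturation would
   give a point outside all translates by coset representatives of H. *)
Lemma envelope_cover D : envelope D ->
  exists s : seq G', forall x, exists2 y, y \in s & D (y^-1 * x).
Proof.
move=> [dD HD]; apply: contrapT => nex; have [r rP] := coset_representatives.
pose A := range e `|` range r.
have A0 : A !=set0 by exists (e 1); left; exists 1.
have eA : range e `<=` A by move=> y; left.
pose miss (s : seq G') := [set x | forall y, y \in s -> ~ D (y^-1 * x)].
have [|||x xP] := saturated_directed (A := A)
    (F := [set X | exists2 s, {in s, forall y, A y} & X = miss s]) E's (bound_absorbs _ _).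
- move=> _ [s sA ->]; elim: s sA => [|y s IH] sA.
    rewrite (_ : miss _ = setT); first exact: definable_setT.
    by apply/seteqP; split=> x // _ y; rewrite in_nil.
  rewrite (_ : miss _ = ~` [set x | D (y^-1 * x)] `&` miss s).
    apply: definable_setI => //.
      apply: definable_setC => //; apply: definable_translate => //.
        by apply: sA; exact: mem_head.
      exact: definable_sub dD.
    by apply: IH => z zs; apply: sA; rewrite in_cons zs orbT.
  apply/seteqP; split=> [x xs|x [xy xs] z].
    split; first by apply: xs; exact: mem_head.
    by move=> z zs; apply: xs; rewrite in_cons zs orbT.
  by rewrite in_cons => /orP[/eqP->|]; [exact: xy|exact: xs].
- move=> _ [s sA ->]; apply: contrapT => nx; apply: nex; exists s => x.
  apply: contrapT => nx'; apply: nx; exists x => y ys Dy; apply: nx'.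
  by exists y.
- move=> _ _ [s sA ->] [t tA ->]; exists (miss (s ++ t)).
    exists (s ++ t) => // y; rewrite mem_cat => /orP[/sA|/tA]//.
  move=> x xst; split=> y ys; apply: xst; rewrite mem_cat ys ?orbT//.
have [j Hj] := rP x.
apply: (xP (miss [:: r j])) (mem_head _ _) (HD _ Hj).
by exists [:: r j] => // y; rewrite mem_seq1 => /eqP->; right; exists j.
Qed.

(** The colour of [x] is a translate of [D'] that contains it. *)
Lemma envelope_coloured D : envelope D -> finitely_coloured D.
Proof.
move=> /envelope_quot[D' eD' D'D]; have [s sP] := envelope_cover eD'.
have /choice[c cP] : forall x, exists i : 'I_(size s), D' ((tnth (in_tuple s) i)^-1 * x).
  move=> x; have [y ys D'y] := sP x.
  have yi : index y s < size s by rewrite index_mem.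
  by exists (Ordinal yi); rewrite (tnth_nth 1) /= nth_index.
exists 'I_(size s), c => x y cxy; set z := tnth (in_tuple s) (c x).
rewrite (_ : x^-1 * y = (z^-1 * x)^-1 * (z^-1 * y)).
  by apply: D'D; [exact: cP|rewrite /z cxy; exact: cP].
by rewrite invgM invgK -mulgA mulVKg.
Qed.

Definition core (D : set G') : set G' := [set x | forall g, D (x ^ g)].

Lemma core_sub D : core D `<=` D.
Proof. by move=> x /(_ 1); rewrite conjg1. Qed.

(* Writing g = y d with d in D1 and D2 and y in the finite set s, the conjugate
   of x by g is d^-1 (x ^ y) d, so only the conjugates by s matter. *)
Lemma core_coloured D : envelope D -> finitely_coloured (core D).
Proof.
move=> /envelope_quot[D1 eD1 D1D]; have [D2 eD2 D2D1] := envelope_quot eD1.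
have [s sP] := envelope_cover (envelopeI eD1 eD2).
have : finitely_coloured [set x | forall y, y \in s -> D2 (x ^ y)^-1].
  apply: (@finitely_coloured_seq _ _ s (fun y => [set x | D2 (x ^ y)^-1])) => y _.
  apply: (@finitely_colouredJ _ [set x | D2 x^-1]).
  exact/finitely_colouredV/envelope_coloured.
apply: finitely_coloured_sub => x xs g.
have [y ys [D1d D2d]] := sP g; set d := y^-1 * g in D1d D2d.
rewrite (_ : g = y * d); last by rewrite /d mulVKg.
rewrite conjgM [_ ^ d]conjgE; apply: D1D => //.
by rewrite -[x ^ y]invgK; apply: D2D1 => //; exact: xs.
Qed.

(** The translating elements come from [G]: one is chosen for each colour that occurs on [G]. Their
    translates cover [G], hence [G'] by [definable_dense]. *)
Lemma core_cover D : envelope D ->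
  exists s : seq G, forall x, exists2 g, g \in s & core D ((e g)^-1 * x).
Proof.
move=> eD; have [T [c cP]] := core_coloured eD.
(* A colour not attained on [G] gets the dummy value 1. *)
have /choice[r rP] : forall t, exists h, forall g, c (e g) = t -> c (e h) = t.
  move=> t; have [[h ht]|nt] := pselect (exists h, c (e h) = t); first by exists h.
  by exists 1 => g gt; case: nt; exists g.
exists [seq r t | t <- enum T] => x.
pose X (s : seq G) := [set x | forall g, g \in s -> ~ core D ((e g)^-1 * x)].
have dX s : Gdef (X s).
  elim: s => [|g s IH].
    rewrite (_ : X _ = setT); first exact: definable_setT.
    by apply/seteqP; split=> y // _ z; rewrite in_nil.
  rewrite (_ : X _ = ~` [set x | core D ((e g)^-1 * x)] `&` X s).
    apply: definable_setI => //; apply: definable_setC => //.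
    apply: definable_translate => //.
    by apply: definable_core => //; case: eD.
  apply/seteqP; split=> [y ys|y [yg ys] z].
    split; first by apply: ys; exact: mem_head.
    by move=> z zs; apply: ys; rewrite in_cons zs orbT.
  by rewrite in_cons => /orP[/eqP->|]; [exact: yg|exact: ys].
have XT : ~` X [seq r t | t <- enum T] = setT.
  apply: definable_dense; first exact: definable_setC.
  move=> g /(_ (r (c (e g)))); apply; first by apply: map_f; rewrite mem_enum.
  by apply: cP; exact: rP.
have : (~` X [seq r t | t <- enum T]) x by rewrite XT.
by move=> nX; apply: contrapT => nex; apply: nX => g gs cg; apply: nex; exists g.
Qed.

Lemma core_quot D D' : (forall x y, D' x -> D' y -> D (x^-1 * y)) ->
  forall x y, core D' x -> core D' y -> core D (x^-1 * y).
Proof. by move=> D'D x y cx cy g; rewrite conjMg conjVg; exact: D'D. Qed.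

Definition cores : set (set G') := [set Q | exists2 D, envelope D & Q = core D].

Lemma cores_nonempty : cores !=set0.
Proof. by exists (core setT); exists setT => //; split=> //; exact: definable_setT. Qed.

Lemma cores_directed P Q : cores P -> cores Q ->
  exists2 R, cores R & R `<=` P `&` Q.
Proof.
move=> [D eD ->] [D' eD' ->]; exists (core (D `&` D')).
  by exists (D `&` D') => //; exact: envelopeI.
by move=> x xDD'; split=> g; case: (xDD' g).
Qed.

Lemma cores1 Q : cores Q -> Q 1.
Proof. by move=> [D [_ HD] ->] g; rewrite conj1g; exact: HD. Qed.

Lemma cores_quot Q : cores Q ->
  exists2 R, cores R & forall x y, R x -> R y -> Q (x^-1 * y).
Proof.
move=> [D eD ->]; have [D' eD' D'D] := envelope_quot eD.
by exists (core D'); [exists D'|exact: core_quot].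
Qed.

Lemma cores_conj Q : cores Q -> forall x g, Q x -> Q (x ^ g).
Proof. by move=> [D _ ->] x g cx h; rewrite -conjgM; exact: cx. Qed.

Definition core_basis : group_basis G' :=
  GroupBasis cores_nonempty cores_directed cores1 cores_quot cores_conj.

Local Notation K := (gb_quotient core_basis).
Local Notation cl := (@gb_class _ core_basis).

(** The definable sets that contain the fibre over almost every point for [F] form a directed
    family; saturation gives an [x] in all of them, and [F] converges to its class. *)
Lemma core_quotient_compact : compact [set: K].
Proof.
rewrite compact_ultra => F UF _.
have [|||x xP] := saturated_directed (F := [set X | Gdef X /\
    F [set k : K | forall x, cl x = k -> X x]]) E's card_embed_range.
- by move=> X [].
- move=> X [_ /filter_ex[k kX]]; exists (gb_repr k); apply: kX.
  exact: gb_reprK.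
- move=> X Y [dX FX] [dY FY]; exists (X `&` Y) => //; split; first exact: definable_setI.
  apply: filterS (filterI FX FY) => k [kX kY] x xk.
  by split; [exact: kX|exact: kY].
exists (cl x); split=> // A /gb_nbhsP[Q BQ QA].
have [R BR RQ] := cores_quot BQ; have [S BS SR] := gb_mul (B := core_basis) BR.
have [D eD SE] := BS; have [s sP] := core_cover eD.
(* Finitely many translates cover the quotient, so [F] contains one of them; a slightly larger
   translate belongs to the family and hence contains [x]. *)
have [|g gs Fg] := ultra_seq (s := s)
    (f := fun g => [set k : K | exists2 y, k = cl y & S ((e g)^-1 * y)]) UF.
  move=> k; have [g gs Sg] := sP (gb_repr k); exists g => //.
  by exists (gb_repr k); rewrite ?gb_reprK// SE.
have Rx : R ((e g)^-1 * x).
  apply: (xP [set x | R ((e g)^-1 * x)]); split.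
    apply: definable_translate => //.
    by have [D' [dD' _] ->] := BR; exact: definable_core.
  apply: filterS Fg => _ [y -> Sy] z /esym/gb_classP yz.
  by rewrite /= -(mulgK y (e g)^-1) -mulgA; apply: SR => //; exact: yz.
apply: filterS Fg => _ [y -> Sy]; apply: QA.
rewrite (_ : x^-1 * y = ((e g)^-1 * x)^-1 * ((e g)^-1 * y)).
  apply: RQ => //; rewrite -(mulg1 (_ * _)); apply: SR => //; exact: cores1 BS.
by rewrite invgM invgK -mulgA mulVKg.
Qed.

Lemma core_quotient_dense : dense (range (cl \o e)).
Proof.
move=> O [k Ok] oO; have : nbhs k O by apply: open_nbhs_nbhs; split.
rewrite -(gb_reprK k); move: (gb_repr k) => x /gb_nbhsP[Q BQ QO].
have [R BR RQ] := gb_sym BQ; have [D eD RE] := BR.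
have [s sP] := core_cover eD; have [g _ Rg] := sP x.
exists (cl (e g)); split; last by exists g.
apply: QO; have [|_] := RQ ((e g)^-1 * x); first by rewrite RE.
by rewrite invgM invgK.
Qed.

End Component.

(** The condition to which both notions are reduced. Continuity of [f] is automatic for the discrete
    topology. *)
Definition trivial_compact_images (G : groupType) : Prop :=
  forall (K : topGroupType) (f : G -> K), compact_hausdorff K ->
    {morph f : x y / x * y} -> dense (range f) -> forall g, f g = 1.

Lemma trivial_compact_images_connected (G : groupType) :
  trivial_compact_images G -> type_absolutely_connected G.
Proof.
move=> Gtriv L E G' E' e eE E's; split.
  split; first by split.
    exists set0; first by move=> q [].
    by apply/seteqP; split=> // x _ q [].
  apply: card_le_trans (card_image_le (fun _ : bound L G => [set: G']) setT).
  apply: subset_card_le => _ [x _ <-]; exists set0 => //.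
move=> H Hb x _; apply: (envelope_bigcap Hb) => D eD.
suff -> : D = setT by [].
apply: (definable_dense eE) => [|g]; first by case: eD.
pose B := core_basis E's Hb.
have fM : {morph gb_class B \o e : x y / x * y}.
  by move=> y z /=; rewrite (elementaryM eE) gb_classM.
have cK : compact_hausdorff (gb_quotient B).
  by split; [exact: (core_quotient_compact eE)|exact: gb_hausdorff].
have := Gtriv _ (gb_class B \o e) cK fM (@core_quotient_dense _ _ _ _ _ _ eE E's _ Hb) g.
(* Triviality of the class of [e g] says that [e g] lies in every core, in particular in that of
   [D]. *)
move=> /esym/gb_classP/(_ (core D) (ex_intro2 _ _ D eD erefl)).
by rewrite invg1 mul1g; exact: core_sub.
Qed.

(** * The Bohr compactification of a discrete group *)

Lemma discrete_continuous (G : groupType) (K : topologicalType)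
    (f : discrete_topology G -> K) : continuous f.
Proof.
move=> x A /= /nbhs_singleton Ax.
by apply: (filterS _ (discrete_set1 x)) => _ ->.
Qed.

Lemma one_is_subgroup (G : groupType) : is_subgroup [set (1 : G)].
Proof. by split=> // [x y -> ->|x ->]; rewrite ?mulg1 ?invg1. Qed.

(** In one direction [f] factors through a [b] that kills [g]; in the other the one-element group is
    a Bohr compactification. *)
Lemma minimally_almost_periodicP (G : groupType) :
  minimally_almost_periodic (discrete_topology G) <-> trivial_compact_images G.
Proof.
split=> [Gmap K f cK fM df g|Gtriv].
  have : von_Neumann_radical (discrete_topology G) g by rewrite Gmap.
  move=> [bG [b [[_ [_ bM] _ /(_ K f cK)]]]].
  case=> // [|f' [[[_ f'M] _ fE] _] bg].
    by split=> //; exact: discrete_continuous.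
  rewrite (_ : f g = f' (b g)); last by rewrite fE.
  by rewrite bg; apply: (mulgI (f' 1)); rewrite -f'M !mulg1.
apply/seteqP; split=> // g _.
pose T := subgroup_type (one_is_subgroup G).
have T1 (x : discrete_topology T) : x = 1.
  by apply: val_inj; rewrite (set_valP x) (set_valP (1 : T)).
exists (discrete_topology T), (fun=> 1); split=> //; split.
- split.
    rewrite (_ : setT = [set 1]); first exact: compact_set1.
    by apply/seteqP; split=> x // _; exact: T1.
  by move=> x y _; rewrite (T1 x) (T1 y).
- by split; [exact: discrete_continuous|move=> x y; rewrite mulg1].
- by move=> O [x Ox] _; exists x; split=> //; exists 1.
- move=> K f cK [_ fM] df; have f1 := Gtriv K f cK fM df.
  (* Every neighbourhood of [k] meets the dense image of [f], which is the point 1; [K] being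
     Hausdorff, [k = 1]. *)
  have K1 k : k = 1 :> K.
    have [_ hK] := cK; apply: hK => A B kA B1.
    have [|z [Az [h _ hz]]] := df A° _ (open_interior _).
      by exists k.
    exists 1; split; last exact: nbhs_singleton.
    by apply: interior_subset; rewrite -(f1 h) hz.
  exists (fun=> 1); split.
    split; first by split; [exact: discrete_continuous|move=> x y; rewrite mulg1].
      by apply/seteqP; split=> k // _; exists 1; rewrite ?(K1 k).
    by apply/funext => h; rewrite f1.
  by move=> f' _; apply/funext => x; rewrite (K1 (f' x)).
Qed.

Lemma type_absolutely_connectedP (G : groupType) :
  type_absolutely_connected G <-> trivial_compact_images G.
Proof.
split; last exact: trivial_compact_images_connected.
by move=> Gtc K f cK fM _; exact: type_absolutely_connected_hom.
Qed.

Lemma setT_is_subgroup (G : groupType) : is_subgroup [set: G].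
Proof. by []. Qed.

(** The radical concerns subgroups as types, where [G] appears only as an isomorphic copy. *)
Lemma trivial_compact_images_setT (G : groupType) (Gsub : is_subgroup [set: G]) :
  trivial_compact_images (subgroup_type Gsub) <-> trivial_compact_images G.
Proof.
pose i (x : G) : subgroup_type Gsub := SigSub (mem_set (I : [set: G] x)).
have iM : {morph i : x y / x * y} by move=> x y; exact: val_inj.
have vi (x : subgroup_type Gsub) : i (val x) = x by exact: val_inj.
split=> triv K f cK fM df.
  move=> g; apply: (triv K (f \o val) cK _ _ (i g)); first by move=> x y /=; rewrite fM.
  rewrite (_ : range _ = range f)//; apply/seteqP; split=> _ [x _ <-].
    by exists (val x).
  by exists (i x).
move=> g; rewrite -(vi g); apply: (triv K (f \o i) cK).
  by move=> x y /=; rewrite iM fM.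
rewrite (_ : range _ = range f)//; apply/seteqP; split=> _ [x _ <-].
  by exists (i x).
by exists (val x) => //=; rewrite vi.
Qed.

Lemma tc_radical_setT (G : groupType) :
  tc_radical G = [set: G] <-> type_absolutely_connected G.
Proof.
split=> [|Gtc].
  (* Were there no largest subgroup, [xget] would return its default [set0], which misses 1. *)
  rewrite /tc_radical; case: xgetP => [H _ [[Hsub Htc] _] HT|_ /seteqP[_ /(_ 1 I)//]].
  rewrite {}HT in Hsub Htc.
  by apply/type_absolutely_connectedP/trivial_compact_images_setT/type_absolutely_connectedP/Htc.
have GT : largest_tac_subgroup [set: G].
  split=> //; exists (setT_is_subgroup G).
  exact/type_absolutely_connectedP/trivial_compact_images_setT/type_absolutely_connectedP.
rewrite /tc_radical; case: xgetP => [H _ [_ Hmax]|/(_ _ GT)//].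
by apply/seteqP; split=> //; exact: Hmax (proj1 GT).
Qed.

Theorem theorem5p10 (G : groupType) :
  (von_Neumann_radical (discrete_topology G) = [set: discrete_topology G]
     <-> tc_radical G = [set: G]) /\
  (type_absolutely_connected G
     <-> minimally_almost_periodic (discrete_topology G)).
Proof.
have tcE : type_absolutely_connected G <->
    minimally_almost_periodic (discrete_topology G).
  exact: iff_trans (type_absolutely_connectedP G)
    (iff_sym (minimally_almost_periodicP G)).
by split=> //; rewrite tc_radical_setT tcE.
Qed.
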